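(* Let $\mathcal{A}$ be a Banach algebra (with bracket $[x,y]=xy-yx$) or, more generally, a Banach-Lie algebra, over $\mathbb{R}$ or $\mathbb{C}$. Assume that there exist $X,Y\in\mathcal{A}$, with $Y\neq 0$, and a scalar $v$ (in the ground field) such that $[X,Y]=vY$. Then the BCH series $(X+Y)+\sum_{n=2}^\infty Z_n(X,Y)$ coincides (term by term) with the series $$(X+Y)+\sum_{n=1}^\infty \frac{(-v)^n B_n}{n!}\,Y .$$ Consequently, the BCH series $\sum_{n=1}^\infty Z_n(X,Y)$ converges in $\mathcal{A}$ if and only if $|v|<2\pi$, and in this case its sum is $$X+\psi(v)\,Y,\qquad \text{where } \psi(v):=\frac{v}{1-e^{-v}}\quad(\psi(0):=1).$$ In particular, if $|v|\geq 2\pi$ the BCH series $\sum_{n=1}^\infty Z_n(X,Y)$ is not convergent.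
   Context: A Banach algebra is a unital associative algebra over $\mathbb{R}$ or $\mathbb{C}$ that is a Banach space with $\|xy\|\le\|x\|\,\|y\|$ for all $x,y$. A Banach-Lie algebra is a Banach space over $\mathbb{R}$ or $\mathbb{C}$ endowed with a Lie algebra structure whose bracket $(x,y)\mapsto[x,y]$ is continuous. The BCH series of $x,y$ is the (homogeneous) series $\sum_{n=1}^\infty Z_n(x,y)$, where $Z_n(x,y)$ is the homogeneous Lie polynomial of degree $n$ $$Z_n(x,y)=\frac1n\sum_{k=1}^n\frac{(-1)^{k+1}}{k}\sum_{\substack{(i_1,j_1),\ldots,(i_k,j_k)\neq(0,0)\\ i_1+j_1+\cdots+i_k+j_k=n}}\frac{(\mathrm{ad}\,x)^{i_1}(\mathrm{ad}\,y)^{j_1}\cdots(\mathrm{ad}\,x)^{i_k}(\mathrm{ad}\,y)^{j_k-1}(y)}{i_1!\,j_1!\cdots i_k!\,j_k!},$$ with $i_r,j_r$ nonnegative integers and $(\mathrm{ad}\,a)(b)=[a,b]$; when $j_k=0$ (so $i_k\ne0$) the summand is understood to end with $(\mathrm{ad}\,x)^{i_k-1}(x)$. Equivalently, $Z_n(x,y)$ is the homogeneous component of degree $n$ of $\ln(e^xe^y)$ in the algebra of formal power series over $\mathbb{Q}$ in two non-commuting indeterminates, written as a Lie polynomial. For instance $Z_1(x,y)=x+y$, $Z_2(x,y)=\tfrac12[x,y]$, $Z_3(x,y)=\tfrac1{12}([[x,y],y]+[[y,x],x])$. Convergence means convergence in norm of the partial sums $\sum_{n=1}^N Z_n(x,y)$.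 The Bernoulli numbers $B_n$ are the rational numbers determined by $\frac{z}{e^z-1}=\sum_{n=0}^\infty\frac{B_n}{n!}z^n$ (so $B_1=-\tfrac12$). *)

(* Defs.v *)
From HB Require Import structures.
From mathcomp Require Import all_boot all_order all_algebra.
From mathcomp Require Import all_classical all_reals all_analysis.
From mathcomp Require Import complex.

Set Implicit Arguments.
Unset Strict Implicit.
Unset Printing Implicit Defensive.

Import Order.TTheory GRing.Theory Num.Theory.
Import numFieldNormedType.Exports.

Local Open Scope classical_set_scope.
Local Open Scope ring_scope.

Variant ground_field := Reals | Complexes.

Section Scalars.
Variable R : realType.

Definition base_field (F : ground_field) : numFieldType :=
  match F with Reals => R | Complexes => R[i] end.

Definition base_of_real (F : ground_field) : R -> base_field F :=
  match F with Reals => fun t : R => t | Complexes => fun t : R => t%:C%C end.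

Definition base_exp (F : ground_field) : base_field F -> base_field F :=
  match F with
  | Reals => @expR R
  | Complexes => fun z : R[i] =>
      (expR (complex.Re z))%:C%C *
      Complex (cos (complex.Im z)) (sin (complex.Im z))
  end.

Definition psi (F : ground_field) (v : base_field F) : base_field F :=
  if v == 0 then 1 else v / (1 - base_exp (- v)).

End Scalars.

Arguments base_of_real {R} F t.
Arguments base_exp {R F} z.
Arguments psi {R F} v.

(* A norm on a module over the numFieldType K takes its values in K; for
   K = R[i] these values are nonnegative, hence real. *)

Section Brackets.
Variables (K : numFieldType) (A : completeNormedModType K).

Record banach_lie_bracket (br : A -> A -> A) : Prop := BanachLieBracket {
  br_linearl : forall (a : K) x y z, br (a *: x + y) z = a *: br x z + br y z;
  br_linearr : forall (a : K) x y z, br z (a *: x + y) = a *: br z x + br z y;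
  br_alternating : forall x, br x x = 0;
  br_jacobi : forall x y z,
    br x (br y z) + br y (br z x) + br z (br x y) = 0;
  br_continuous : continuous (fun p : A * A => br p.1 p.2)
}.

Record banach_algebra (one : A) (mul : A -> A -> A) : Prop := BanachAlgebra {
  mul_assoc : forall x y z, mul x (mul y z) = mul (mul x y) z;
  mul_onel : forall x, mul one x = x;
  mul_oner : forall x, mul x one = x;
  mul_linearl : forall (a : K) x y z,
    mul (a *: x + y) z = a *: mul x z + mul y z;
  mul_linearr : forall (a : K) x y z,
    mul z (a *: x + y) = a *: mul z x + mul z y;
  mul_norm : forall x y, `|mul x y| <= `|x| * `|y|
}.

Definition commutator (mul : A -> A -> A) (x y : A) : A := mul x y - mul y x.

Definition banach_bracket (br : A -> A -> A) : Prop :=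
  banach_lie_bracket br \/
  exists one mul, banach_algebra one mul /\ br = commutator mul.

Lemma banach_algebra_mulDl one mul x y z : banach_algebra one mul ->
  mul (x + y) z = mul x z + mul y z.
Proof. by move=> /mul_linearl/(_ 1 x y z); rewrite !scale1r. Qed.

Lemma banach_algebra_mulDr one mul x y z : banach_algebra one mul ->
  mul z (x + y) = mul z x + mul z y.
Proof. by move=> /mul_linearr/(_ 1 x y z); rewrite !scale1r. Qed.

Lemma banach_algebra_mulBl one mul x y z : banach_algebra one mul ->
  mul (x - y) z = mul x z - mul y z.
Proof.
move=> mulP; apply/eqP.
by rewrite eq_sym subr_eq -(banach_algebra_mulDl _ _ _ mulP) subrK.
Qed.

Lemma banach_algebra_mulBr one mul x y z : banach_algebra one mul ->
  mul z (x - y) = mul z x - mul z y.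
Proof.
move=> mulP; apply/eqP.
by rewrite eq_sym subr_eq -(banach_algebra_mulDr _ _ _ mulP) subrK.
Qed.

Lemma banach_algebra_continuous one mul : banach_algebra one mul ->
  continuous (fun p : A * A => mul p.1 p.2).
Proof.
move=> mulP [/= k x]; apply/cvgrPdist_lt => _/posnumP[e]; near +oo_K => M.
near=> l z => /=; have M0 : 0 < M by [].
rewrite (@distm_lt_split _ _ (mul k z)) // -?(banach_algebra_mulBr _ _ _ mulP)
  -?(banach_algebra_mulBl _ _ _ mulP).
  rewrite (le_lt_trans (mul_norm mulP _ _))//.
  rewrite (@le_lt_trans _ _ (M * `|x - z|)) ?ler_wpM2r -?ltr_pdivlMl//.
  by near: z; apply: cvgr_dist_lt; rewrite // mulr_gt0 ?invr_gt0.
rewrite (le_lt_trans (mul_norm mulP _ _))//.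
rewrite (@le_lt_trans _ _ (`|k - l| * M)) ?ler_wpM2l -?ltr_pdivlMr//.
  by near: z; near: M; apply: cvg_bounded (@cvg_refl _ _).
by near: l; apply: cvgr_dist_lt; rewrite // divr_gt0.
Unshelve. all: by end_near. Qed.

Lemma commutator_banach_lie one mul :
  banach_algebra one mul -> banach_lie_bracket (commutator mul).
Proof.
move=> mulP; split; rewrite /commutator.
- move=> a x y z; rewrite (mul_linearl mulP) (mul_linearr mulP).
  by rewrite opprD addrACA scalerBr.
- move=> a x y z; rewrite (mul_linearl mulP) (mul_linearr mulP).
  by rewrite opprD addrACA scalerBr.
- by move=> x; rewrite subrr.
- move=> x y z.
  rewrite !(banach_algebra_mulBl _ _ _ mulP) !(banach_algebra_mulBr _ _ _ mulP).
  rewrite !(mul_assoc mulP).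
  move: (mul (mul x y) z) (mul (mul x z) y) (mul (mul y z) x)
    (mul (mul z y) x) (mul (mul y x) z) (mul (mul z x) y) => a b c d e f.
  rewrite !opprB ![_ - _ + (_ - _)]addrACA -!opprD.
  by rewrite [c + b]addrC [f + e]addrC [d + a]addrC !subrKA subrr.
- move=> p; apply: cvgB; first exact: banach_algebra_continuous mulP p.
  apply: (@continuous_comp _ _ _ (fun p : A * A => (p.2, p.1))
    (fun p : A * A => mul p.1 p.2));
    last exact: banach_algebra_continuous mulP _.
  by apply: cvg_pair => /=; [exact: cvg_snd|exact: cvg_fst].
Qed.

End Brackets.

Section BCH.
Variables (K : fieldType) (A : lmodType K) (br : A -> A -> A).
Implicit Types x y : A.

Definition ad x : A -> A := br x.

(* (ad x)^i1 (ad y)^j1 ... (ad x)^ik (ad y)^(jk - 1) (y), ending with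
   (ad x)^(ik - 1) (x) when jk = 0. *)
Fixpoint ad_word x y (s : seq (nat * nat)) : A :=
  match s with
  | [::] => 0
  | [:: (i, j)] =>
      if (0 < j)%N then iter i (ad x) (iter j.-1 (ad y) y)
      else iter i.-1 (ad x) x
  | (i, j) :: s' => iter i (ad x) (iter j (ad y) (ad_word x y s'))
  end.

(* Exponents are bounded by the degree n, so the inner sum ranges over the
   finite type of k-tuples of pairs (i_r, j_r) with entries in {0, ..., n}. *)
Definition BCH_Z (n : nat) x y : A :=
  n%:R^-1 *: \sum_(1 <= k < n.+1) ((-1) ^+ k.+1 / k%:R) *:
    \sum_(s : k.-tuple ('I_n.+1 * 'I_n.+1) |
        all (fun p : 'I_n.+1 * 'I_n.+1 =>
               (p.1 != 0 :> nat) || (p.2 != 0 :> nat)) s &&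
        (\sum_(p <- s) (p.1 + p.2) == n)%N)
      (\prod_(p <- s) (p.1`! * p.2`!)%N%:R)^-1 *:
        ad_word x y [seq (val p.1, val p.2) | p <- s].

Definition BCH_partial_sum x y (N : nat) : A :=
  \sum_(1 <= n < N.+1) BCH_Z n x y.

End BCH.

(* The first n coefficients of the formal power series z / (e^z - 1), the
   inverse of \sum_m z^m / (m + 1)!. *)
Fixpoint bernoulli_coefs (n : nat) : seq rat :=
  if n is m.+1 then
    let s := bernoulli_coefs m in
    rcons s ((m == 0)%N%:R - \sum_(k < m) s`_k / (m - k).+1`!%:R)
  else [::].

Definition bernoulli_number (n : nat) : rat := n`!%:R * (bernoulli_coefs n.+1)`_n.

Lemma size_bernoulli_coefs n : size (bernoulli_coefs n) = n.
Proof. by elim: n => //= n IHn; rewrite size_rcons IHn. Qed.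

Lemma nth_bernoulli_coefs n k :
  (k < n)%N -> (bernoulli_coefs n)`_k = bernoulli_number k / k`!%:R.
Proof.
rewrite /bernoulli_number [_ * _`_k]mulrC mulfK; last first.
  by rewrite pnatr_eq0 -lt0n fact_gt0.
elim: n => // n IHn; rewrite ltnS leq_eqVlt => /predU1P[-> //|kn].
by rewrite [LHS]/= nth_rcons size_bernoulli_coefs kn IHn.
Qed.

(* (e^z - 1) * \sum_n (B_n / n!) z^n = z, compared coefficientwise. *)
Lemma bernoulli_generating (n : nat) :
  \sum_(k < n.+1) ((k < n)%N%:R / (n - k)`!%:R) * (bernoulli_number k / k`!%:R)
    = (n == 1)%N%:R.
Proof.
rewrite big_ord_recr /= ltnn mul0r mul0r addr0.
case: n => [|m]; first by rewrite big_ord0.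
rewrite big_ord_recr /= ltnSn subSnn divr1 mul1r.
rewrite -(@nth_bernoulli_coefs m.+1)// /= nth_rcons.
rewrite size_bernoulli_coefs ltnn eqxx.
rewrite eqSS addrC -addrA [- _ + _]addrC -[RHS]addr0; congr (_ + _).
apply/eqP; rewrite subr_eq0; apply/eqP/eq_bigr => k _.
rewrite (ltn_trans (ltn_ord k)) // nth_bernoulli_coefs // subSn 1?ltnW //.
by rewrite mul1r mulrC.
Qed.

(* Main.v *)
Require Import Defs.
From mathcomp Require Import all_boot all_order all_algebra.
From mathcomp Require Import all_classical all_reals all_analysis.
From mathcomp Require Import complex ring lra.

(* Write b_n = B_n / n! and f = t / (e^t - 1).
   When [X, Y] = v Y, the only words in ad X and ad Y that survive end with Y,
   or with (ad Y) X, and apply nothing but powers of ad X to it.  Summing them,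
   (n + 1) Z_(n + 1) is v^n Y times the coefficient of t^n in
     sum_k ((-1)^(k+1) / k) e^t ((e^t - 1)^(k-1) - t (e^t - 1)^(k-2)),
   where the term in (e^t - 1)^(k-2) is absent for k = 1,
   and this series is (t f)' + 2 t, because the logarithm of e^t is t.
   Formal identities are proved for truncated polynomials, modulo powers of 'X.
   From t f' = f - t f - f^2, the series g = f - 1 + t / 2 satisfies the Riccati
   equation (t g)' = t^2 / 4 - g^2.  It shows that g is even, and, by comparison
   with h = 1 - (y / 2) cot (y / 2), which solves (y h)' = h^2 + y^2 / 4 on
   ]0, 2 pi[, that sum_n |b_n| y^n converges there.  Multiplying partial sums
   gives f (z) (e^z - 1) = z for |z| < 2 pi.  If b_n (2 pi)^n tended to 0, then
   f (i y) would be o (1 / (2 pi - y)) as y -> 2 pi, which is impossible since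
   f (i y) (e^(i y) - 1) = i y and |e^(i y) - 1| <= 2 (2 pi - y). *)

Import Order.TTheory GRing.Theory Num.Theory.
Import numFieldNormedType.Exports.
Local Open Scope classical_set_scope.
Local Open Scope ring_scope.

Set Implicit Arguments.
Unset Strict Implicit.
Unset Printing Implicit Defensive.

(** * Truncated exponential, logarithm and Bernoulli series *)

Section TruncatedSeries.
Variable K : numFieldType.
Implicit Types p q : {poly K}.

(** Divisibility of a difference by ['X^n] stands for equality of power series modulo t^n. *)
Lemma dvdXnP n p :
  reflect (forall i, (i < n)%N -> p`_i = 0) ('X^n %| p).
Proof.
apply: (iffP idP) => [/dvdpP[q ->] i ltin|p0]; first by rewrite coefMXn ltin.
apply/dvdpP; exists (drop_poly n p); rewrite -[LHS](poly_take_drop n).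
rewrite [take_poly n p](_ : _ = 0) ?add0r//; apply/polyP => i.
by rewrite coef_take_poly coef0; case: ifP => // /p0.
Qed.

Lemma dvdXn_deriv n p : 'X^(n.+1) %| p -> 'X^n %| p^`().
Proof.
move=> /dvdXnP p0; apply/dvdXnP => i lin.
by rewrite coef_deriv p0 ?mul0rn.
Qed.

Lemma dvdXn_int n p : p`_0 = 0 -> 'X^n %| p^`() -> 'X^(n.+1) %| p.
Proof.
move=> p0 /dvdXnP dp0; apply/dvdXnP => -[//|i] lin.
by have /eqP := dp0 i lin; rewrite coef_deriv mulrn_eq0/= => /eqP.
Qed.

(** A nonzero constant term makes [q] coprime to ['X], that is, invertible as a power series. *)
Lemma dvdXn_mul_unit n p q : q`_0 != 0 -> ('X^n %| q * p) = ('X^n %| p).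
Proof.
move=> q0; apply: Gauss_dvdpr; rewrite coprimep_expl// coprimep_sym.
by rewrite -[X in coprimep _ X]subr0 coprimep_XsubC /root horner_coef0.
Qed.

(** The series (e^t - 1) / t, kept apart from its factor ['X] because it is a unit modulo powers of
    ['X]. Note the degrees: [expm1_poly N] and [exp_poly N] are exact up to t^N, whereas
    [bern_poly N] stops at t^(N-1). *)
Definition expm1_divX N : {poly K} := \poly_(i < N) (i.+1`!%:R)^-1.
Definition expm1_poly N : {poly K} := 'X * expm1_divX N.
Definition exp_poly N : {poly K} := 1 + expm1_poly N.

Definition bern n : K := ratr (bernoulli_number n) / n`!%:R.
Definition bern_poly N : {poly K} := \poly_(i < N) bern i.

Lemma expm1_divX0 N : (expm1_divX N.+1)`_0 = 1.
Proof. by rewrite coef_poly/= invr1. Qed.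

Lemma coef_expm1 N i : (i <= N)%N ->
  (expm1_poly N)`_i = (0 < i)%N%:R / i`!%:R.
Proof.
by case: i => [|i] iN; rewrite coefXM/= ?mul0r// coef_poly iN mul1r.
Qed.

Lemma coef_exp N i : (i <= N)%N -> (exp_poly N)`_i = i`!%:R^-1.
Proof.
move=> iN; rewrite coefD coef1 coef_expm1//.
by case: i iN => [|i] _ /=; rewrite ?mul0r ?addr0 ?invr1// add0r mul1r.
Qed.

Lemma dvdXn_exp_deriv N : 'X^N %| (expm1_poly N)^`() - exp_poly N.
Proof.
apply/dvdXnP => i iN; rewrite coefB coef_deriv coef_expm1//.
rewrite coef_exp ?(ltnW iN)//.
rewrite mul1r -[X in X - _]mulr_natr factS natrM invfM mulrAC.
by rewrite mulVf ?mul1r ?subrr ?pnatr_eq0.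
Qed.

Lemma bern_expm1 N : 'X^(N.+1) %| bern_poly N.+1 * expm1_poly N - 'X.
Proof.
apply/dvdXnP => i; rewrite ltnS => iN; rewrite coefB coefX coefM.
rewrite -[X in _ - X](rmorph_nat (@ratr K)) -bernoulli_generating rmorph_sum/=.
apply/eqP; rewrite subr_eq0; apply/eqP/eq_bigr => k _.
have ki : (k <= i)%N by rewrite -ltnS ltn_ord.
rewrite coef_poly ltnS (leq_trans ki iN) coef_expm1; last first.
  by rewrite (leq_trans (leq_subr _ _)).
by rewrite subn_gt0 rmorphM/= !fmorph_div/= !rmorph_nat mulrC.
Qed.

(** With u = e^t - 1, the claim times u is a combination of f u - t, of its derivative and of u' -
    e^t. The derivative costs one order of precision and cancelling the factor ['X] of u costs
    another, hence the drop from [N.+3] to [N.+1]. *)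
Lemma bern_riccati_dvd N :
  'X^(N.+1) %| 'X * (bern_poly N.+3)^`() - bern_poly N.+3
    + 'X * bern_poly N.+3 + bern_poly N.+3 ^+ 2.
Proof.
set f := bern_poly N.+3; set u := expm1_poly N.+2; set e := exp_poly N.+2.
have fu : 'X^(N.+3) %| f * u - 'X by exact: bern_expm1.
have due : 'X^(N.+2) %| u^`() - e by exact: dvdXn_exp_deriv.
have := dvdXn_deriv fu; rewrite derivB derivM derivX => dfu.
have fu' : 'X^(N.+2) %| f * u - 'X by apply: dvdp_trans fu; rewrite dvdp_exp2l.
have eu : e = 1 + u by [].
rewrite -(@dvdXn_mul_unit _ _ (expm1_divX N.+2)) ?expm1_divX0 ?oner_eq0//.
rewrite -(dvdp_mul2l _ _ (negbT (polyX_eq0 K))) mulrA -exprS.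
rewrite -[_ * expm1_divX _]/u.
rewrite [X in _ %| X](_ : _ = 'X * (f^`() * u + f * u^`() - 1)
  - ('X * f) * (u^`() - e) + (f * u - 'X) * (f - 1)); last first.
  by rewrite eu; ring.
apply: dvdp_add; last exact: dvdp_mulr.
by apply: dvdp_sub; exact: dvdp_mull.
Qed.

End TruncatedSeries.

(** * Riccati recurrence, parity, and summation over the word lengths *)

Section BernoulliSeries.
Variable K : numFieldType.
Implicit Types p q : {poly K}.
Local Notation bern := (@bern K).

Lemma bernoulli_number0 : bernoulli_number 0 = 1.
Proof.
have := bernoulli_generating 1; rewrite !big_ord_recr big_ord0/=.
by rewrite !subnn subn0 !divr1 !mul0r add0r mul1r addr0.
Qed.

Lemma bernoulli_number1 : bernoulli_number 1 = - 2^-1.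
Proof.
have := bernoulli_generating 2; rewrite !big_ord_recr big_ord0/=.
rewrite bernoulli_number0 !subn0 !divr1 mul0r add0r addr0 !mul1r.
by move=> /eqP; rewrite addrC addr_eq0 => /eqP ->.
Qed.

Lemma bern0 : bern 0 = 1.
Proof. by rewrite /bern bernoulli_number0 rmorph1 divr1. Qed.

Lemma bern1 : bern 1 = - 2^-1.
Proof.
by rewrite /bern bernoulli_number1 rmorphN fmorphV rmorph_nat divr1.
Qed.

(* Coefficients of z / (e^z - 1) - 1 + z / 2 = (z / 2) coth (z / 2) - 1. *)
Definition bern_tail n : K := if (2 <= n)%N then bern n else 0.

Lemma bern_riccati n : (2 <= n)%N ->
  n.+1%:R * bern_tail n =
    (n == 2)%:R / 4 - \sum_(i < n.+1) bern_tail i * bern_tail (n - i).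
Proof.
move=> n2.
have /dvdXnP/(_ n) := bern_riccati_dvd K n; rewrite leqnn => /(_ isT).
set f := bern_poly K _.
pose g := \poly_(i < n.+3) bern_tail i.
have fg : f = 1 - 2^-1 *: 'X + g.
  apply/polyP => i; rewrite !(coefD, coefN, coefZ, coefX, coef1, coef_poly).
  rewrite /bern_tail.
  case: i => [|[|i]]; rewrite /= ?bern0 ?bern1 ?mulr0; ring.
rewrite (_ : _ + f ^+ 2 = 'X * g^`() + g - 4^-1 *: 'X^2 + g * g); last first.
  have -> : f^`() = - (2^-1 *: 1) + g^`().
    by rewrite fg derivD derivB derivZ derivX -polyC1 derivC sub0r.
  rewrite fg -!mul_polyC mulr1; have -> : (4^-1 : K)%:P = 2^-1%:P * 2^-1%:P.
    by rewrite -polyCM -invfM -natrM.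
  have : (2^-1 : K)%:P *+ 2 = 1.
    by rewrite -polyCMn -[_ *+ 2]mulr_natr mulVf ?pnatr_eq0.
  move: (2^-1%:P) => h h2.
  (* [ring] cannot use h + h = 1; the two sides differ exactly by the multiple of [1 - h *+ 2]
     inserted here. *)
  have -> : 'X * g^`() + g =
      'X * g^`() + g + ('X * g + 'X - h * 'X^2) * (1 - h *+ 2).
    by rewrite h2 subrr mulr0 addr0.
  ring.
have gE i : (i <= n)%N -> g`_i = bern_tail i.
  by move=> ilen; rewrite coef_poly ltnS (leq_trans ilen)// ltnW.
rewrite !coefD coefN coefZ coefXn coefXM coefM gE//.
rewrite (_ : (if _ then _ else _) = n%:R * bern_tail n); last first.
  by case: (n) n2 gE => // m _ gE; rewrite coef_deriv gE// mulr_natl.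
rewrite (eq_bigr (fun i : 'I_n.+1 => bern_tail i * bern_tail (n - i))).
  by move=> E; apply/eqP; rewrite -subr_eq0 -[X in _ == X]E; apply/eqP; ring.
by move=> i _; rewrite !gE ?leq_subr// -ltnS.
Qed.

(** For odd n, one of i and n - i is odd, so by strong induction every product in the recurrence
    vanishes; the extreme ones vanish because [bern_tail 0] is 0, and the source term sits in degree
    2. *)
Lemma bern_tail_odd n : odd n -> bern_tail n = 0.
Proof.
have [m] := ubnP n; elim: m n => // m IH n /ltnSE nm nodd.
have [n2|n2] := leqP 2 n; last by rewrite /bern_tail leqNgt n2.
apply/eqP; rewrite -(mulrI_eq0 _ (@lregP _ n.+1%:R _)) ?pnatr_eq0//.
rewrite bern_riccati// big1 ?subr0; last first.
  move=> [i /= ilt] _; have [->|i0] := posnP i; first by rewrite mul0r.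
  have [->|in_] := eqVneq i n; first by rewrite subnn mulr0.
  have {}ilt : (i < n)%N by rewrite ltn_neqAle in_ -ltnS.
  have [io|ie] := boolP (odd i).
    by rewrite IH ?mul0r// (leq_trans ilt).
  rewrite [X in _ * X]IH ?mulr0//.
    by rewrite (leq_trans _ nm)// ltn_subrL i0 (leq_trans _ n2).
  by rewrite oddB ?nodd//= ?ie// ltnW.
by have [n2E|_] := eqVneq n 2; [rewrite n2E in nodd|rewrite mul0r].
Qed.

(** This is f (-t) = f (t) + t: apart from b_1, only even indices contribute. *)
Lemma bern_opp n : (-1) ^+ n * bern n = bern n + (n == 1)%:R.
Proof.
case: n => [|[|n]]; first by rewrite mul1r addr0.
  by rewrite bern1 expr1 (_ : (1 == 1)%N%:R = 1)//; field.
rewrite addr0; have [no|ne] := boolP (odd n.+2).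
  by rewrite (_ : bern _ = bern_tail n.+2)// bern_tail_odd ?mulr0.
by rewrite -signr_odd (negbTE ne) mul1r.
Qed.

Definition log_coef k : K := (-1) ^+ k.+1 / k%:R.

(** The formal identity log (e^t) = t. Both sides vanish at 0, so derivatives are compared: with u'
    = 1 + u the geometric sum telescopes, leaving (-u)^n, which is a multiple of t^n. *)
Lemma log_poly_dvd n N : (n <= N)%N ->
  'X^(n.+1) %| \sum_(1 <= k < n.+1) log_coef k *: expm1_poly K N ^+ k - 'X.
Proof.
move=> nN; apply: dvdXn_int.
  rewrite coefB coefX subr0 coef_sum big_nat big1// => -[//|k] _.
  by rewrite coefZ exprS /expm1_poly -mulrA coefXM mulr0.
set u := expm1_poly K N; set e := exp_poly K N.
have eu : e = 1 + u by [].
have due : 'X^n %| u^`() - e.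
  by apply: dvdp_trans (dvdXn_exp_deriv K N); rewrite dvdp_exp2l.
have -> : (\sum_(1 <= k < n.+1) log_coef k *: u ^+ k - 'X)^`() =
    u^`() * (\sum_(i < n) (- u) ^+ i) - 1.
  rewrite derivB derivX raddf_sum/= big_add1/= big_mkord mulr_sumr.
  congr (_ - _); apply: eq_bigr => i _.
  rewrite derivZ deriv_exp/= -[_ *+ i.+1]scaler_nat scalerA.
  rewrite /log_coef mulfVK ?pnatr_eq0// -mul_polyC rmorphXn rmorphN rmorph1.
  by rewrite (exprNn u) 2!exprS !mulN1r opprK mulrCA.
have -> : u^`() * (\sum_(i < n) (- u) ^+ i) - 1 =
    (u^`() - e) * (\sum_(i < n) (- u) ^+ i) - (- u) ^+ n.
  have -> : (- u) ^+ n = (- u - 1) * (\sum_(i < n) (- u) ^+ i) + 1.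
    by rewrite -subrX1 subrK.
  by rewrite eu; ring.
apply: dvdp_sub; first exact: dvdp_mulr.
rewrite exprNn; apply: dvdp_mull.
by rewrite /u /expm1_poly exprMn; apply: dvdp_mulr.
Qed.

(* [v^n] times the coefficient of degree [n] is the contribution to [Y] of the
   words with [k] pairs of exponents and degree [n + 1]. *)
Definition word_poly N k : {poly K} :=
  exp_poly K N * (expm1_poly K N ^+ k.-1
    - (2 <= k)%:R *: ('X * expm1_poly K N ^+ k.-2)).

(** Put u = e^t - 1 = t / f. By the logarithm, the sum of [log_coef k] u^(k-1) is f; without k = 1,
    the sum of [log_coef k] u^(k-2) is (f - 1) / u. The total is e^t (f - t (f - 1) / u) = 2 f + 2 t
    - t f - f^2, which t f' = f - t f - f^2 turns into (t f)' + 2 t. *)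
Lemma sum_word_poly_dvd n N : (n <= N)%N ->
  'X^n %| \sum_(1 <= k < n.+1) log_coef k *: word_poly N k
    - ('X * bern_poly K N.+1)^`() - 'X *+ 2.
Proof.
case: N => [|N] nN; first by move: nN; rewrite leqn0 => /eqP ->; rewrite dvd1p.
set f := bern_poly K _; set u := expm1_poly K N.+1; set e := exp_poly K N.+1.
pose w := expm1_divX K N.+1.
have uE : u = 'X * w by [].
have eE : e = 1 + u by [].
pose W1 := \sum_(1 <= k < n.+1) log_coef k *: u ^+ k.-1.
pose W2 := \sum_(1 <= k < n.+1) ((2 <= k)%:R * log_coef k) *: u ^+ k.-2.
have -> : \sum_(1 <= k < n.+1) log_coef k *: word_poly N.+1 k
    = e * (W1 - 'X * W2).
  rewrite /W1 /W2 mulr_sumr -sumrB mulr_sumr; apply: eq_bigr => k _.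
  rewrite /word_poly -/e -/u -!mul_polyC (polyCM _ (log_coef k)); ring.
have lP : 'X^(n.+1) %| u * W1 - 'X.
  rewrite (_ : u * W1 = \sum_(1 <= k < n.+1) log_coef k *: u ^+ k).
    exact: log_poly_dvd.
  rewrite /W1 mulr_sumr big_nat [RHS]big_nat; apply: eq_bigr => -[//|k] _.
  by rewrite -scalerAr -exprS.
have [->|n0] := posnP n; first by rewrite dvd1p.
have W12 : W1 = u * W2 + 1.
  rewrite /W1 /W2 [in LHS]big_ltn//= [in RHS]big_ltn//= mul0r scale0r add0r.
  rewrite /log_coef expr0 addrC; congr (_ + _).
    rewrite mulr_sumr big_nat [RHS]big_nat; apply: eq_bigr => -[//|[//|k]] _.
    by rewrite mul1r -scalerAr -exprS.
  by rewrite divr1 -signr_odd expr0 scale1r.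
have aP : 'X^(N.+2) %| f * u - 'X by exact: bern_expm1.
have dP := dvdXn_deriv aP; rewrite derivB derivM derivX in dP.
have eP : 'X^(N.+1) %| u^`() - e by exact: dvdXn_exp_deriv.
(* Multiplying by u^2 = t^2 w^2 removes the divisions by u; what remains is an explicit combination
   of the remainders [lP], [aP], [dP] and [eP], at the price of two orders. *)
rewrite -(@dvdXn_mul_unit _ _ _ (w ^+ 2)); last first.
  by rewrite expr2 coef0M expm1_divX0 mulr1 oner_eq0.
rewrite -(dvdp_mul2l _ _ (negbT (polyX_eq0 K))).
rewrite -(dvdp_mul2l _ _ (negbT (polyX_eq0 K))) -!exprS.
have le2 m (p : {poly K}) : (n <= m)%N -> 'X^(m.+2) %| p -> 'X^(n.+2) %| p.
  by move=> nm; apply: dvdp_trans; rewrite dvdp_exp2l.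
rewrite derivM derivX; set D := (X in _ ^+ 2 * X).
rewrite (_ : 'X * _ = 'X ^+ 2 * (u^`() - e)
  + 'X * (e * (w - 1) * (u * W1 - 'X)) - u * (f * u - 'X)
  - 'X^2 * (w * (f^`() * u + f * u^`() - 1)) + 'X * (u^`() * (f * u - 'X)));
  last first.
  rewrite /D W12; move: (u^`()) (f^`()) => u' f'.
  by rewrite eE uE; clear; move: W2 => W; ring.
have dX2 (p : {poly K}) : 'X^(N.+1) %| p -> 'X^(n.+2) %| 'X^2 * p.
  move=> pP; apply: (le2 _ _ nN).
  by rewrite (exprD 'X 2) dvdp_mul2l// expf_neq0// polyX_eq0.
have dX m (p : {poly K}) : (n <= m)%N -> 'X^(m.+1) %| p -> 'X^(n.+2) %| 'X * p.
  move=> nm pP; apply: (le2 _ _ nm).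
  by rewrite exprS dvdp_mul2l// polyX_eq0.
apply: dvdp_add; last by apply: (dX N.+1) => //; apply: dvdp_mull.
apply: dvdp_sub; last by apply: dX2; apply: dvdp_mull.
apply: dvdp_sub; last first.
  by rewrite {1}uE -mulrA; apply: (dX N.+1) => //; apply: dvdp_mull.
by apply: dvdp_add; [exact: dX2|apply: (dX n) => //; apply: dvdp_mull].
Qed.

(** The extra 2 t matters only at n = 1, where n + 1 = 2, so it is n + 1 times the correction in
    [bern_opp]: it produces the sign (-1)^n. *)
Lemma sum_word_poly n N : (0 < n)%N -> (n < N)%N ->
  \sum_(1 <= k < n.+2) log_coef k * (word_poly N k)`_n
    = n.+1%:R * ((-1) ^+ n * bern n).
Proof.
move=> n0 nN; have /dvdXnP/(_ n (ltnSn n)) := sum_word_poly_dvd nN.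
rewrite !coefB coef_deriv coefXM/= coef_poly ltnS (ltnW nN) coefMn coefX.
rewrite coef_sum (eq_bigr _ (fun k _ => coefZ _ _ _)) => /eqP.
rewrite subr_eq0 subr_eq => /eqP ->; rewrite bern_opp mulrDr mulr_natl addrC.
congr (_ + _); have [->|_] := eqVneq n 1; last by rewrite mulr0 mul0rn.
by rewrite mulr1.
Qed.

End BernoulliSeries.

(** * Evaluation of the words *)

Lemma big_tuple_cons (V : nmodType) (T : finType) k (P : pred (seq T))
    (G : seq T -> V) :
  \sum_(s : k.+1.-tuple T | P s) G s
    = \sum_(x : T) \sum_(s : k.-tuple T | P (x :: s)) G (x :: s).
Proof.
rewrite pair_big_dep/=.
rewrite (reindex (fun p : T * k.-tuple T => [tuple of p.1 :: p.2]))//=.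
exists (fun s : k.+1.-tuple T => (thead s, [tuple of behead s])) => [[x s]|s] _.
  by congr pair; apply: val_inj.
by rewrite -tuple_eta.
Qed.

Lemma big_tuple0 (V : nmodType) (T : finType) (P : pred (seq T))
    (G : seq T -> V) :
  \sum_(s : 0.-tuple T | P s) G s = if P [::] then G [::] else 0.
Proof.
rewrite big_mkcond/= (big_pred1 [tuple])// => s /=.
by rewrite [s]tuple0; apply/esym/eqP.
Qed.

Lemma sum_delta (K : pzSemiRingType) n k :
  \sum_(0 <= i < n) (i == k)%:R = (k < n)%:R :> K.
Proof.
elim: n => [|n IH]; first by rewrite big_geq.
rewrite big_nat_recr//= IH [in RHS]ltnS [in RHS]leq_eqVlt [k == n]eq_sym.
by have [->|_] := eqVneq n k; rewrite /= ?ltnn ?add0r ?addr0.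
Qed.

Section Words.
Variables (K : numFieldType) (A : lmodType K) (br : A -> A -> A).
Hypothesis brl : forall (a : K) x y z, br (a *: x + y) z = a *: br x z + br y z.
Hypothesis brr : forall (a : K) x y z, br z (a *: x + y) = a *: br z x + br z y.
Hypothesis brxx : forall x, br x x = 0.
Variables (X Y : A) (v : K).
Hypothesis brXY : br X Y = v *: Y.

Lemma iter_ad0 x i : iter i (br x) 0 = 0.
Proof.
have br0 : br x 0 = 0.
  by have := brr (-1) 0 0 x; rewrite !scaleN1r !addNr.
by elim: i => //= i ->.
Qed.

Lemma iter_ad_linear x i (a : K) y z :
  iter i (br x) (a *: y + z) = a *: iter i (br x) y + iter i (br x) z.
Proof. by elim: i => //= i ->; rewrite brr. Qed.

Lemma iter_adZ x i a y : iter i (br x) (a *: y) = a *: iter i (br x) y.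
Proof.
by have := iter_ad_linear x i a y 0; rewrite iter_ad0 !addr0.
Qed.

Lemma iter_adD x i y z :
  iter i (br x) (y + z) = iter i (br x) y + iter i (br x) z.
Proof. by have := iter_ad_linear x i 1 y z; rewrite !scale1r. Qed.

Lemma iter_ad_sum x i (I : Type) (r : seq I) (P : pred I) (G : I -> A) :
  iter i (br x) (\sum_(j <- r | P j) G j)
    = \sum_(j <- r | P j) iter i (br x) (G j).
Proof. exact: (big_morph _ (iter_adD x i) (iter_ad0 x i)). Qed.

Lemma brYX : br Y X = - v *: Y.
Proof.
have := brxx (1 *: X + Y); rewrite brl !brr !brxx !scale1r add0r addr0.
by rewrite brXY scaleNr => /eqP; rewrite addrC addr_eq0 => /eqP.
Qed.

Lemma iter_adXY i : iter i (br X) Y = v ^+ i *: Y.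
Proof.
elim: i => [|i IH]; first by rewrite scale1r.
by rewrite iterSr brXY iter_adZ IH scalerA -exprS.
Qed.

Lemma iter_adXX i : iter i (br X) X = (i == 0)%N%:R *: X.
Proof. by case: i => [|i]; rewrite ?scale1r// iterSr brxx iter_ad0 scale0r. Qed.

Lemma iter_adYY j : iter j (br Y) Y = (j == 0)%N%:R *: Y.
Proof. by case: j => [|j]; rewrite ?scale1r// iterSr brxx iter_ad0 scale0r. Qed.

Lemma iter_adYX j :
  iter j (br Y) X = (j == 0)%N%:R *: X + (- ((j == 1)%N%:R * v)) *: Y.
Proof.
case: j => [|j]; first by rewrite scale1r mul0r oppr0 scale0r addr0.
by rewrite iterSr brYX iter_adZ iter_adYY scalerA mulrC mulrN scale0r add0r.
Qed.

(** The inner sum of [BCH_Z], with the bound [d] on the exponents separated from the degree [m]: the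
    recursion on [k] lowers the degree while the index type stays fixed. *)
Definition word_sum d k m : A :=
  \sum_(s : k.-tuple ('I_d.+1 * 'I_d.+1) |
      all (fun p : 'I_d.+1 * 'I_d.+1 =>
             (p.1 != 0 :> nat) || (p.2 != 0 :> nat)) s &&
      (\sum_(p <- s) (p.1 + p.2) == m)%N)
    (\prod_(p <- s) (p.1`! * p.2`!)%N%:R)^-1 *:
      ad_word br X Y [seq (val p.1, val p.2) | p <- s].

Lemma word_sumS d k m : word_sum d k.+2 m =
  \sum_(p : 'I_d.+1 * 'I_d.+1 |
      ((p.1 != 0 :> nat) || (p.2 != 0 :> nat)) && (p.1 + p.2 <= m)%N)
    (p.1`! * p.2`!)%N%:R^-1 *:
      iter p.1 (br X) (iter p.2 (br Y) (word_sum d k.+1 (m - (p.1 + p.2))%N)).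
Proof.
pose nz (p : 'I_d.+1 * 'I_d.+1) := (p.1 != 0 :> nat) || (p.2 != 0 :> nat).
pose P (s : seq ('I_d.+1 * 'I_d.+1)) :=
  all nz s && (\sum_(p <- s) (p.1 + p.2) == m)%N.
pose G (s : seq ('I_d.+1 * 'I_d.+1)) :=
  (\prod_(p <- s) (p.1`! * p.2`!)%N%:R)^-1 *:
    ad_word br X Y [seq (val p.1, val p.2) | p <- s].
rewrite [LHS](@big_tuple_cons _ _ k.+1 P G) [RHS]big_mkcond/=.
apply: eq_bigr => p _; rewrite -/(nz p).
case: ifPn => [/andP[nzp pm]|].
  rewrite !iter_ad_sum scaler_sumr; apply: eq_big => [s|s _].
    rewrite /P/= nzp big_cons; congr (_ && _).
    by rewrite -{1}(subnKC pm) eqn_add2l.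
  rewrite /G !iter_adZ scalerA big_cons invfM; congr (_ *: _).
  (* The tail has [k.+1] pairs, hence is not empty, and [ad_word] takes its recursive branch. *)
  by case: s => -[|q s] i.
rewrite negb_and => np; rewrite big_pred0// => s; rewrite /P/= big_cons.
apply/negbTE; case/orP: np => [/negbTE->//|mp].
by apply/negP => /andP[_ /eqP E]; rewrite -E leq_addr in mp.
Qed.

Lemma sum_pairs_nat (V : nmodType) d (P : nat -> nat -> bool)
    (G : nat -> nat -> V) :
  \sum_(p : 'I_d * 'I_d | P p.1 p.2) G p.1 p.2
    = \sum_(0 <= i < d) \sum_(0 <= j < d | P i j) G i j.
Proof.
rewrite big_mkord.
under [RHS]eq_bigr do rewrite big_mkord.
by rewrite pair_big_dep.
Qed.

(** Effect of prefixing one pair (i, j) on the generating polynomial [r] of the [Y]-components. On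
    [Y], only j = 0 and i > 0 survive, which multiplies [r] by e^t - 1. The flag [a] tells whether
    degree 1 also contains [X]; on [X], only j = 1 survives, since [Y, X] = - v Y, and any power of
    ad X may follow, which subtracts t e^t. *)
Lemma word_sum_step d m (a : bool) (r : {poly K}) (W : nat -> A) :
  (m < d)%N -> W 0 = 0 ->
  (forall i, (i <= m)%N ->
    W i.+1 = (a && (i == 0%N))%:R *: X + (v ^+ i * r`_i) *: Y) ->
  \sum_(p : 'I_d.+1 * 'I_d.+1 |
      ((p.1 != 0 :> nat) || (p.2 != 0 :> nat)) && (p.1 + p.2 <= m.+1)%N)
    (p.1`! * p.2`!)%N%:R^-1 *:
      iter p.1 (br X) (iter p.2 (br Y) (W (m.+1 - (p.1 + p.2))%N))
  = (v ^+ m * (expm1_poly K d * r - a%:R *: ('X * exp_poly K d))`_m) *: Y.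
Proof.
move=> md W0 WS.
have WE i j n : (n <= m)%N -> iter i (br X) (iter j (br Y) (W n.+1)) =
    ((a && (n == 0%N))%:R * (j == 0%N)%:R * (i == 0%N)%:R) *: X
    + (v ^+ i * ((j == 0%N)%:R * (v ^+ n * r`_n)
                 - (a && (n == 0%N))%:R * (j == 1%N)%:R * v)) *: Y.
  move=> nm; rewrite WS// iter_adD !iter_adZ iter_adYY iter_adYX.
  rewrite scalerDr !iter_adD !iter_adZ iter_adXX iter_adXY.
  rewrite !scalerA -addrA -scalerDl; congr (_ + _ *: _); ring.
pose T i j : A := (i`! * j`!)%N%:R^-1 *:
  iter i (br X) (iter j (br Y) (W (m.+1 - (i + j))%N)).
pose P i j := ((i != 0) || (j != 0))%N && (i + j <= m.+1)%N.
rewrite (sum_pairs_nat _ P T).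
pose c i j : K := (j == 0%N)%:R * ((0 < i <= m)%N%:R / i`!%:R * r`_(m - i))
  - a%:R * (j == 1%N)%:R * (i.+1 == m)%:R / i`!%:R.
have TE i j : (if P i j then T i j else 0) = (v ^+ m * c i j) *: Y.
  have c0 : ~~ [&& (i != 0%N) || (j != 0%N) & (i + j <= m)%N] -> c i j = 0.
    rewrite /c; case: j => [|[|j]] /=; rewrite ?addn0 ?addn1 ?orbT ?orbF.
    - by rewrite lt0n => /negbTE->; rewrite !(mulr0, mul0r) subr0.
    - move=> im; have -> : (i.+1 == m) = false.
        by apply: contraNF im => /eqP <-; rewrite ltnSn.
      by rewrite !(mulr0, mul0r) subr0.
    - by rewrite !(mulr0, mul0r) subr0.
  rewrite /P; have [nz|z] := boolP ((i != 0%N) || (j != 0%N)); last first.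
    by rewrite c0 ?(negbTE z)// mulr0 scale0r.
  (* When i + j = m + 1 nothing is left for the tail, and [W 0] is 0. *)
  rewrite leq_eqVlt /=; have [ijm|_] := eqVneq; rewrite /=.
    by rewrite c0 /T ijm ?subnn ?W0 ?iter_ad0 ?nz ?ltnn// scaler0 mulr0 scale0r.
  rewrite ltnS; have [ijm|mij] := leqP; last first.
    by rewrite c0 ?mulr0 ?scale0r// nz -ltnNge.
  rewrite /T subSn// WE ?leq_subr// natrM invfM.
  move: nz ijm; rewrite /c; case: j {c0} => [|[|j]] /=.
  - rewrite orbF addn0 fact0 => i0 im.
    rewrite (negbTE i0) lt0n i0 im !(mulr0, mul0r) scale0r add0r subr0 scalerA.
    rewrite -{3}(subnKC im) exprD; congr (_ *: _) => /=; rewrite invr1; ring.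
  - rewrite orbT addn1 => _ im.
    rewrite subn_eq0 [i.+1 == m]eqn_leq im /= !(mulr0, mul0r) scale0r add0r.
    rewrite sub0r scalerA.
    rewrite invr1 mulr1 sub0r; congr (_ *: _).
    have [mi|_] := leqP m i.+1; rewrite ?andbF ?andbT /=; last by ring.
    have -> : m = i.+1 by apply/eqP; rewrite eqn_leq mi.
    by rewrite exprS; ring.
  - by move=> _ _; rewrite !(mulr0, mul0r, subr0, scale0r, addr0, scaler0).
under eq_bigr do rewrite big_mkcond/=.
under eq_bigr do under eq_bigr do rewrite TE.
under eq_bigr do rewrite -scaler_suml -mulr_sumr.
rewrite -scaler_suml -mulr_sumr; congr ((_ * _) *: _).
case: d md => // d md.
have sumj i : \sum_(0 <= j < d.+2) c i j =
    (0 < i <= m)%N%:R / i`!%:R * r`_(m - i) - a%:R * (i.+1 == m)%:R / i`!%:R.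
  rewrite big_ltn// big_ltn// big_nat big1 ?addr0; last first.
    by move=> [|[|j]]// _; rewrite /c/= !(mulr0, mul0r) subr0.
  by rewrite /c/= !(mulr0, mul0r, mulr1, mul1r) subr0 add0r.
under eq_bigr do rewrite sumj.
rewrite sumrB coefB coefZ coefXM coefM; congr (_ - _).
  rewrite -(big_mkord xpredT (fun i => (expm1_poly K d.+1)`_i * r`_(m - i))).
  rewrite (big_nat_widen _ _ d.+2) 1?ltnW// [RHS]big_mkcond/=.
  apply: eq_big_nat => i _; rewrite ltnS; have [im|mi] := leqP i m.
    by rewrite coef_expm1 ?andbT// (leq_trans im)// ltnW.
  by rewrite andbF !mul0r.
case: m md {P T WE sumj c TE WS} => [|m] md /=.
  by rewrite mulr0 big1// => i _; rewrite mul0r.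
rewrite coef_exp; last by rewrite ltnW// ltnW.
rewrite (big_cat_nat _ (n := m.+1))//=; last by rewrite ltnW// ltnW.
rewrite [X in _ + X](_ : _ = 0) ?addr0; last first.
  rewrite big_nat big1// => i /andP[mi _].
  by rewrite eqSS gtn_eqF// mulr0 mul0r.
rewrite big_nat_recr//= big_nat big1 ?add0r ?eqxx ?mulr1//.
by move=> i im; rewrite eqSS ltn_eqF// mulr0 mul0r.
Qed.

Lemma word_sum0 d k : word_sum d k.+1 0 = 0.
Proof.
rewrite /word_sum big1// => s /andP[/allP nz /eqP s0].
have := nz (thead s); rewrite mem_nth ?size_tuple// => /(_ isT).
move: s0; rewrite {1}[s]tuple_eta big_cons => /eqP.
by rewrite !addn_eq0 => /andP[/andP[-> ->]].
Qed.

(** Among single pairs, only (1, 0), which gives [X], and (m, 1), which gives v^m / m! times [Y],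
    contribute: the polynomial is e^t. Longer words follow from [word_sum_step], whose flag is set
    only in passing from one pair to two; this explains the factor [(2 <= k)%:R] in [word_poly]. *)
Lemma word_sumE d k m : (m < d)%N -> word_sum d k.+1 m.+1 =
  ((k == 0%N) && (m == 0%N))%:R *: X
    + (v ^+ m * (word_poly K d k.+1)`_m) *: Y.
Proof.
elim: k m => [|k IH] m md.
  pose P (s : seq ('I_d.+1 * 'I_d.+1)) :=
    all (fun p : 'I_d.+1 * 'I_d.+1 =>
             (p.1 != 0 :> nat) || (p.2 != 0 :> nat)) s
    && (\sum_(p <- s) (p.1 + p.2) == m.+1)%N.
  pose G (s : seq ('I_d.+1 * 'I_d.+1)) :=
    (\prod_(p <- s) (p.1`! * p.2`!)%N%:R)^-1 *:
      ad_word br X Y [seq (val p.1, val p.2) | p <- s].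
  rewrite [LHS](@big_tuple_cons _ _ 0 P G) (eq_bigr _ (fun x _ =>
    big_tuple0 (fun s => P (x :: s)) (fun s => G (x :: s)))).
  rewrite -big_mkcond/=.
  pose T i j : A := (i`! * j`!)%N%:R^-1 *: ad_word br X Y [:: (i, j)].
  pose P' i j := ((i != 0) || (j != 0))%N && (i + j == m.+1)%N.
  rewrite (eq_big (fun p : 'I_d.+1 * 'I_d.+1 => P' p.1 p.2)
    (fun p : 'I_d.+1 * 'I_d.+1 => T p.1 p.2)); first last.
  - by move=> p _; rewrite /G/= big_seq1.
  - by move=> p; rewrite /P/= big_seq1 andbT.
  rewrite sum_pairs_nat.
  have TE i j : (if P' i j then T i j else 0) =
      ((m == 0%N)%:R * (i == 1%N)%:R * (j == 0%N)%:R) *: X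
      + (v ^+ m / m`!%:R * (i == m)%:R * (j == 1%N)%:R) *: Y.
    rewrite /P'/T; case: j => [|[|j]] /=.
    - rewrite addn0 orbF mulr0 scale0r addr0 iter_adXX scalerA.
      case: i => [|[|i]] /=; rewrite ?(mulr0, mul0r, mulr1, scale0r, scaler0)//.
        by rewrite eqSS eq_sym !invr1; case: (m == 0%N); rewrite ?scale0r.
      by case: ifP.
    - rewrite addn1 eqSS orbT mulr0 scale0r add0r mulr1 iter_adXY scalerA.
      have [->|] := eqVneq i m; last by rewrite mulr0 scale0r.
      by rewrite mulr1 muln1 mulrC.
    - rewrite !mulr0 !scale0r addr0 -[ad br Y _]/(iter j.+1 (br Y) Y).
      rewrite iter_adYY scale0r iter_ad0 scaler0.
      by case: ifP.
  under eq_bigr do rewrite big_mkcond/=.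
  under eq_bigr do under eq_bigr do rewrite TE.
  under eq_bigr do rewrite big_split/= -2!scaler_suml -!mulr_sumr !sum_delta.
  rewrite big_split/= -[\sum_(0 <= _ < _) _ *: X]scaler_suml.
  rewrite -[\sum_(0 <= _ < _) _ *: Y]scaler_suml.
  rewrite -!mulr_suml -!mulr_sumr !sum_delta.
  rewrite !ltnS (leq_ltn_trans _ md)// (ltnW md) !mulr1.
  congr (_ + (_ * _) *: _).
  by rewrite /word_poly expr0 scale0r subr0 mulr1 coef_exp// ltnW.
rewrite word_sumS.
rewrite (@word_sum_step d m (k == 0%N) (word_poly K d k.+1)) ?word_sum0//.
  rewrite /= scale0r add0r; congr ((_ * (polyseq _)`__) *: _).
  rewrite /word_poly/=; case: k {IH} => [|k] /=.
    by rewrite !expr0 scale0r subr0 expr1 !scale1r; ring.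
  by rewrite !scale1r scale0r subr0 !exprS; ring.
by move=> i im; rewrite IH// (leq_ltn_trans im).
Qed.

Lemma BCH_Z1 : BCH_Z br 1 X Y = X + Y.
Proof.
rewrite /BCH_Z big_nat1 -/(word_sum 1 1 1) word_sumE// scalerA.
rewrite !invr1 !expr0 expr2 mulrNN !mulr1 !scale1r mul1r.
by rewrite /word_poly expr0 scale0r subr0 mulr1 coef_exp// invr1 scale1r.
Qed.

(** The factor n + 1 from [sum_word_poly] cancels the normalization of [BCH_Z]. *)
Lemma BCH_ZS n : (0 < n)%N ->
  BCH_Z br n.+1 X Y = ((- v) ^+ n * bern K n) *: Y.
Proof.
move=> n0; rewrite /BCH_Z.
rewrite (eq_big_nat _ _ (F2 := fun k =>
    (v ^+ n * (log_coef K k * (word_poly K n.+1 k)`_n)) *: Y)); last first.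
  move=> [//|k] _; rewrite -/(word_sum n.+1 k.+1 n.+1) word_sumE//.
  by rewrite (gtn_eqF n0) andbF scale0r add0r scalerA /log_coef mulrCA.
rewrite -scaler_suml -mulr_sumr sum_word_poly// scalerA; congr (_ *: _).
by rewrite mulrCA mulKf ?pnatr_eq0// mulrA -exprMn mulrN1.
Qed.

End Words.

(** * A majorant on the disk of radius 2 pi *)

Section CotangentMajorant.
Variable R : realType.
Implicit Types x y : R.

Lemma le_of_is_derive_ge0 (f df : R -> R) a b : a <= b ->
  (forall x, a <= x <= b -> is_derive x 1 f (df x)) ->
  (forall x, a <= x <= b -> 0 <= df x) -> f a <= f b.
Proof.
move=> ab fdf df0.
have [||c cab E] := @MVT_segment _ f df a b ab.
- by move=> x; rewrite in_itv/= => /andP[ax xb]; apply: fdf; rewrite !ltW.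
- apply: derivable_within_continuous => x; rewrite in_itv/= => xab.
  by have [] := fdf x xab.
- by rewrite -subr_ge0 E mulr_ge0 ?subr_ge0// df0// -[X in is_true X]in_itv.
Qed.

Lemma mulr_cos_le_sin x : 0 <= x <= pi -> x * cos x <= sin x.
Proof.
move=> /andP[x0 xpi]; rewrite -subr_ge0.
have := @le_of_is_derive_ge0 (fun t => sin t - t * cos t)
  (fun t => t * sin t) 0 x x0.
rewrite sin0 mul0r subr0; apply => t /andP[t0 tx].
  apply: is_derive_eq; rewrite /GRing.scale/=; ring.
by rewrite mulr_ge0// sin_ge0_pi// t0 (le_trans tx).
Qed.

Lemma sin_le_id x : 0 <= x -> sin x <= x.
Proof.
move=> x0; rewrite -subr_ge0.
have := @le_of_is_derive_ge0 (fun t => t - sin t) (fun t => 1 - cos t) 0 x x0.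
by rewrite sin0 subr0; apply => t _; rewrite subr_ge0 cos_le1.
Qed.

Lemma one_sub_cos_le x : 0 <= x -> 1 - cos x <= x.
Proof.
move=> x0; rewrite -subr_ge0.
have := @le_of_is_derive_ge0 (fun t => t + cos t) (fun t => 1 - sin t) 0 x x0.
rewrite cos0 add0r => H; suff : 1 <= x + cos x by move: (cos x) => c; lra.
by apply: H => t _; rewrite subr_ge0 sin_le1.
Qed.

(** Formally - g (i y), where g is the series with coefficients [bern_tail]. *)
Definition cot_fun y : R := 1 - y / 2 * (cos (y / 2) / sin (y / 2)).

Lemma sin_half_gt0 y : 0 < y < 2 * pi -> 0 < sin (y / 2).
Proof. by move=> y2; apply: sin_gt0_pi; move: (pi) y2 => p; lra. Qed.

Lemma cot_fun_ge0 y : 0 < y < 2 * pi -> 0 <= cot_fun y.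
Proof.
move=> y2; have s0 := sin_half_gt0 y2.
rewrite /cot_fun mulrA subr_ge0 ler_pdivrMr// mul1r mulr_cos_le_sin//.
by move: (pi) y2 => p; lra.
Qed.

Lemma is_derive_cot_fun y : 0 < y < 2 * pi ->
  is_derive y 1 (fun t => t * cot_fun t) (cot_fun y ^+ 2 + y ^+ 2 / 4).
Proof.
move=> y2; have s0 := sin_half_gt0 y2.
have half : is_derive y 1 (fun t : R => t / 2) (1 / 2).
  apply: is_derive_eq; rewrite /GRing.scale/=; ring.
have dsin : is_derive y 1 (fun t => sin (t / 2)) (cos (y / 2) / 2).
  by apply: is_derive_eq; rewrite /GRing.scale/=; ring.
have dcos : is_derive y 1 (fun t => cos (t / 2)) (- sin (y / 2) / 2).
  by apply: is_derive_eq; rewrite /GRing.scale/=; ring.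
have dinv : is_derive y 1 (fun t => (sin (t / 2))^-1)
    (- (sin (y / 2)) ^- 2 * (cos (y / 2) / 2)).
  exact: (@is_deriveV _ (fun t => sin (t / 2)) y _ 1 (lt0r_neq0 s0) dsin).
rewrite /cot_fun; apply: is_derive_eq; rewrite /GRing.scale/=.
by move: (cos _) (sin _) (lt0r_neq0 s0) => c s s_neq0; field.
Qed.

Local Notation bt := (fun n => `|bern_tail R n|).

Definition bern_abs_poly N : {poly R} := \poly_(n < N) bt n.

(** The triangle inequality in [bern_riccati], coefficient by coefficient. The products with index 0
    or n vanish there, so a coefficient of degree n involves only smaller indices: [N] terms on the
    right control [N.+1] on the left, which permits an induction on [N]. *)
Lemma bern_abs_poly_deriv_le N y : 0 <= y ->
  ('X * bern_abs_poly N.+1)^`().[y]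
    <= (bern_abs_poly N).[y] ^+ 2 + y ^+ 2 / 4.
Proof.
move=> y0; rewrite -subr_ge0.
rewrite (_ : _ - _ = (bern_abs_poly N ^+ 2 + 4^-1 *: 'X^2
    - ('X * bern_abs_poly N.+1)^`()).[y]); last first.
  by rewrite !(hornerD, hornerN, horner_exp, hornerZ, hornerX) [4^-1 * _]mulrC.
set D := (X in X.[y]).
rewrite (@horner_coef_wide _ (size D)) ?leqnn// sumr_ge0// => -[n /= _] _.
rewrite mulr_ge0 ?exprn_ge0// /D.
rewrite coefB coefD coefZ coefXn coef_deriv coefXM/= coef_poly expr2 coefM.
have S0 :
    0 <= \sum_(j < n.+1) (bern_abs_poly N)`_j * (bern_abs_poly N)`_(n - j).
  by apply: sumr_ge0 => j _; rewrite !coef_poly mulr_ge0//; case: ifP.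
have [nN|nN] := ltnP n N.+1; last first.
  by rewrite mul0rn subr0 addr_ge0// mulr_ge0.
have [n2|n2] := ltnP n 2.
  have -> : bern_tail R n = 0 by rewrite /bern_tail leqNgt n2.
  by rewrite normr0 mul0rn subr0 addr_ge0// mulr_ge0.
rewrite (_ : _ *+ n.+1 = `|n.+1%:R * bern_tail R n|); last first.
  by rewrite normrM normr_nat mulr_natl.
rewrite bern_riccati// subr_ge0.
apply: le_trans (ler_normB _ _) _; rewrite addrC lerD//; last first.
  by rewrite ger0_norm ?mulr_ge0// mulrC.
apply: le_trans (ler_norm_sum _ _ _) _; apply: ler_sum => -[j jn] _ /=.
rewrite normrM.
have bE i : (i <= n)%N -> i != n -> (bern_abs_poly N)`_i = bt i.
  move=> ilen inen; rewrite coef_poly (leq_trans _ (nN : (n <= N)%N))//.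
  by rewrite ltn_neqAle inen.
have [->|jnn] := eqVneq j n.
  by rewrite subnn normr0 !mulr0 mulr_ge0 ?coef_poly//; case: ifP.
have [->|j0] := posnP j.
  by rewrite normr0 !mul0r mulr_ge0 ?coef_poly//; case: ifP.
rewrite (bE j)// bE ?leq_subr//.
by rewrite neq_ltn ltn_subrL j0 (leq_trans _ n2).
Qed.

Lemma bern_abs_poly_ge0 N y : 0 <= y -> 0 <= (bern_abs_poly N).[y].
Proof.
move=> y0; rewrite horner_poly sumr_ge0// => i _.
by rewrite mulr_ge0// exprn_ge0.
Qed.

Lemma bern_abs_poly_mono N :
  {in Num.nneg &, {homo horner (bern_abs_poly N) : x y / x <= y}}.
Proof.
move=> x y x0 y0 xy; rewrite !horner_poly ler_sum// => i _.
by rewrite ler_wpM2l// lerXn2r.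
Qed.

(* Comparison for the Riccati equation of [cot_fun]: near 0, where both sides
   vanish, [y * cot_fun y] is only known to be nonnegative. *)
Lemma bern_abs_poly_le N y :
  0 < y < 2 * pi -> (bern_abs_poly N).[y] <= cot_fun y.
Proof.
elim: N y => [|N IH] y y2.
  by rewrite /bern_abs_poly poly_def big_ord0 horner0 cot_fun_ge0.
have [y0 y2p] := andP y2.
rewrite -(ler_pM2l y0) -subr_ge0.
set b := (bern_abs_poly N.+1).[y].
suff lb e : 0 < e -> e < y -> - e * b <= y * cot_fun y - y * b.
  have b0 : 0 <= b by rewrite bern_abs_poly_ge0// ltW.
  rewrite leNgt; apply/negP => lt0.
  set d := y * cot_fun y - y * b in lb lt0.
  (* Small enough that e b < - d, which contradicts [lb]; [b + 1] avoids a division by 0. *)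
  pose e := Num.min (y / 2) (- d / (2 * (b + 1))).
  have e0 : 0 < e.
    by rewrite lt_min divr_gt0//= divr_gt0 ?oppr_gt0// mulr_gt0// ltr_wpDl.
  have ey : e < y.
    by rewrite gt_min; apply/orP; left; move: y0; clear; lra.
  have ed : e * (2 * (b + 1)) <= - d.
    by rewrite -ler_pdivlMr ?ge_min ?lexx ?orbT// mulr_gt0// ltr_wpDl.
  have := lb e e0 ey; move: ed e0 lt0 b0; clear; nra.
move=> e0 ey.
have itv t : e <= t <= y -> 0 < t < 2 * pi.
  by move=> /andP[et ty]; rewrite (lt_le_trans e0 et) (le_lt_trans ty).
pose q := 'X * bern_abs_poly N.+1.
(* The difference is nondecreasing on [e, y]: its derivative is at least the difference of the
   squares, which is nonnegative by the induction hypothesis. *)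
have : e * cot_fun e - q.[e] <= y * cot_fun y - q.[y].
  apply: (@le_of_is_derive_ge0 (fun t => t * cot_fun t - q.[t])
    (fun t => cot_fun t ^+ 2 + t ^+ 2 / 4 - q^`().[t])); first exact: ltW.
    by move=> t /itv t2; have := is_derive_cot_fun t2 => ?; apply: is_deriveB.
  move=> t /itv t2; have t0 : 0 <= t by case/andP: t2 => /ltW.
  rewrite subr_ge0; apply: le_trans (bern_abs_poly_deriv_le N t0) _.
  by rewrite lerD2r; apply: lerXn2r (IH _ t2);
    rewrite nnegrE; [exact: bern_abs_poly_ge0|exact: cot_fun_ge0].
rewrite /q !hornerE => lemono; apply: le_trans lemono.
have c0 : 0 <= e * cot_fun e.
  by apply: mulr_ge0; [exact: ltW|apply/cot_fun_ge0/itv; rewrite lexx ltW].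
rewrite mulNr -[X in X <= _]add0r lerD// lerN2 ler_pM2l//.
by rewrite bern_abs_poly_mono ?nnegrE// ltW.
Qed.

End CotangentMajorant.

(** * Multiplying truncated series *)

Lemma horner_exp_poly (K : numFieldType) N (z : K) :
  (exp_poly K N).[z] = \sum_(0 <= i < N.+1) z ^+ i / i`!%:R.
Proof.
rewrite (@horner_coef_wide _ N.+1); last first.
  apply/leq_sizeP => -[//|i] iN; rewrite coefD coef1 add0r coefXM/= coef_poly.
  by rewrite ltnNge -ltnS iN.
by rewrite big_mkord; apply: eq_bigr => -[i iN] _; rewrite coef_exp 1?mulrC.
Qed.

Lemma cvg_exp_poly (R : realType) (x : R) :
  (exp_poly R n).[x] @[n --> \oo] --> expR x.
Proof.
have : series (exp_coeff x) @ \oo --> expR x by exact: is_cvg_series_exp_coeff.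
by rewrite -cvg_shiftS; under [in X in _ -> X]eq_fun do rewrite horner_exp_poly.
Qed.

Lemma exp_poly_le (R : realType) N (x : R) :
  0 <= x -> (exp_poly R N).[x] <= expR x.
Proof.
move=> x0; rewrite horner_exp_poly -/(series (exp_coeff x) N.+1).
apply: nondecreasing_cvgn_le; last exact: is_cvg_series_exp_coeff.
apply/nondecreasing_seqP => n; rewrite seriesSr lerDl.
exact: exp_coeff_ge0.
Qed.

(** The summand 1 + x / 2 accounts for b_0 = 1 and |b_1| = 1 / 2, which [bern_tail] omits. The bound
    does not depend on [N]. *)
Lemma bern_poly_abs_le (R : realType) N (x : R) : 0 < x < 2 * pi ->
  (\poly_(i < N) `|bern R i|).[x] <= 1 + x / 2 + cot_fun x.
Proof.
move=> x2; have x0 : 0 <= x by case/andP: x2 => /ltW.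
apply: le_trans (_ : (1 + 2^-1 *: 'X + bern_abs_poly R N).[x] <= _).
  rewrite -subr_ge0 -hornerN -hornerD; set D := (X in X.[x]).
  rewrite horner_coef sumr_ge0// => -[i /= ilt] _.
  rewrite mulr_ge0 ?exprn_ge0//.
  rewrite /D !(coefD, coefN, coefZ, coefX, coef1) !coef_poly /bern_tail.
  case: i {ilt} => [|[|i]] /=; rewrite ?bern0 ?bern1 ?normrN.
  - rewrite normr0 normr1 mulr0.
    by case: ifP => _; rewrite !addr0 ?subrr ?subr0.
  - by rewrite normr0 ger0_norm//; case: ifP => _; lra.
  - by rewrite mulr0 !add0r subrr.
rewrite !(hornerD, hornerZ, hornerX, hornerC) lerD ?bern_abs_poly_le//.
by rewrite mulrC.
Qed.

(* [K] stands for [R] or [R[i]], whose norms are [K]-valued, but real. *)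
Section RealNorms.
Variables (R : realType) (K : numFieldType) (iota : {rmorphism R -> K}).
Hypothesis norm_real : forall z : K, exists r : R, `|z| = iota r.
Hypothesis iota_le : {mono iota : x y / x <= y}.

Let iota_lt : {mono iota : x y / x < y}.
Proof. exact: leW_mono. Qed.

Let iota0_le x : (0 <= iota x) = (0 <= x).
Proof. by rewrite -(rmorph0 iota) iota_le. Qed.

Lemma norm_iota x : `|iota x| = iota `|x|.
Proof.
have [x0|x0] := leP 0 x; first by rewrite !ger0_norm ?iota0_le.
by rewrite !ltr0_norm ?rmorphN// -(rmorph0 iota) iota_lt.
Qed.

Lemma norm_realP (z : K) : exists2 r : R, 0 <= r & `|z| = iota r.
Proof.
by have [r zr] := norm_real z; exists r => //; rewrite -iota0_le -zr.
Qed.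

Lemma gt0_real (e : K) : 0 < e -> exists2 r : R, 0 < r & e = iota r.
Proof.
move=> e0; have [r er] := norm_real e; rewrite gtr0_norm// in er.
by exists r => //; rewrite -iota_lt rmorph0 -er.
Qed.

Lemma norm_bern n : `|bern K n| = iota `|bern R n|.
Proof.
by rewrite -norm_iota /bern fmorph_div/= fmorph_rat rmorph_nat.
Qed.

Lemma cvg0_le_real (V : normedModType K) (x : nat -> V) (u : nat -> R) :
  (forall n, `|x n| <= iota (u n)) -> u @ \oo --> 0 -> x @ \oo --> 0.
Proof.
move=> xu /cvgr0_norm_lt u0; apply/cvgr0Pnorm_lt => e /gt0_real[r r0 ->].
near=> n; apply: le_lt_trans (xu n) _; rewrite iota_lt.
by apply: le_lt_trans (ler_norm _) _; near: n; exact: u0.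
Unshelve. all: by end_near. Qed.

Lemma cvg0_real_eq (V : normedModType K) (x : nat -> V) (u : nat -> R) :
  (forall n, `|x n| = iota (u n)) -> x @ \oo --> 0 -> u @ \oo --> 0.
Proof.
move=> xu /cvgr0_norm_lt x0; apply/cvgr0Pnorm_lt => e e0.
have ie0 : 0 < iota e by rewrite -(rmorph0 iota) iota_lt.
near=> n; rewrite -iota_lt -norm_iota -xu normr_id.
by near: n; exact: x0.
Unshelve. all: by end_near. Qed.

Lemma norm_horner_le (p : {poly K}) (P : {poly R}) z r :
  (forall i, `|p`_i| <= iota P`_i) -> `|z| <= iota r ->
  `|p.[z]| <= iota P.[r].
Proof.
move=> pP zr; set n := maxn (size p) (size P).
rewrite (@horner_coef_wide _ n) ?leq_maxl//.
rewrite (@horner_coef_wide _ n P) ?leq_maxr//.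
rewrite rmorph_sum/=; apply: le_trans (ler_norm_sum _ _ _) _.
apply: ler_sum => i _; rewrite normrM normrX rmorphM rmorphXn/=.
apply: ler_pM => //.
by rewrite lerXn2r// nnegrE// (le_trans _ zr).
Qed.

(* A product of two series, truncated at order [N], differs from the product
   of the truncations by terms of order larger than [N]; these are geometrically
   small inside a larger disk. *)
Lemma norm_truncated_mul_le N (p q D : {poly K}) (P Q : {poly R}) z r rho :
  (forall i, `|p`_i| <= iota P`_i) -> (forall i, `|q`_i| <= iota Q`_i) ->
  (forall i, (i <= N)%N -> D`_i = 0) ->
  (forall i, (N < i)%N -> D`_i = (p * q)`_i) ->
  `|z| <= iota r -> 0 <= r -> r <= rho -> 0 < rho ->
  `|D.[z]| <= iota ((r / rho) ^+ N.+1 * (P.[rho] * Q.[rho])).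
Proof.
move=> pP qQ D0 Dpq zr r0 rrho rho0.
have PQ i : `|(p * q)`_i| <= iota (P * Q)`_i.
  rewrite !coefM rmorph_sum/=; apply: le_trans (ler_norm_sum _ _ _) _.
  by apply: ler_sum => j _; rewrite normrM rmorphM ler_pM.
have PQ0 i : 0 <= (P * Q)`_i.
  by rewrite -iota0_le (le_trans _ (PQ i)).
pose S : {poly R} := \poly_(i < size (P * Q)) ((N < i)%N%:R * (P * Q)`_i).
have SE i : S`_i = (N < i)%N%:R * (P * Q)`_i.
  by rewrite coef_poly; case: ltnP => // /leq_sizeP ->; rewrite ?mulr0.
apply: (@le_trans _ _ (iota S.[r])).
  apply: norm_horner_le => // i; rewrite SE.
  have [iN|iN] := ltnP N i; first by rewrite mul1r Dpq.
  by rewrite mul0r D0// normr0 rmorph0.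
rewrite iota_le -hornerM horner_poly horner_coef mulr_sumr.
apply: ler_sum => i _.
have [iN|iN] := ltnP N i; last first.
  by rewrite !mul0r !mulr_ge0 ?exprn_ge0 ?divr_ge0 ?(ltW rho0).
rewrite mul1r mulrCA ler_wpM2l//.
have -> : r ^+ i = (r / rho) ^+ i * rho ^+ i.
  by rewrite -exprMn divfK// gt_eqF.
rewrite ler_wpM2r ?exprn_ge0 ?(ltW rho0)//.
by rewrite ler_wiXn2l// ?divr_ge0 ?(ltW rho0)// ler_pdivrMr// mul1r.
Qed.

Lemma cvg_geometric_bound (c q : R) (x : nat -> K) : 0 <= q < 1 ->
  (forall n, `|x n| <= iota (q ^+ n.+1 * c)) -> x @ \oo --> 0.
Proof.
move=> /andP[q0 q1] xq; apply: cvg0_le_real xq _.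
rewrite -[X in _ --> X](mul0r c); apply: cvgMr_tmp.
by rewrite (cvg_shiftS (fun n => q ^+ n)); apply: cvg_expr; rewrite ger0_norm.
Qed.

(** The product of the truncations agrees with t up to degree n + 1. On the circle of radius [rho],
    halfway between r and 2 pi, both majorants are bounded uniformly in n, so the remainder at [z]
    is geometrically small in r / rho. *)
Lemma cvg_bern_expm1 (z : K) (r : R) : `|z| = iota r -> r < 2 * pi ->
  (bern_poly K n.+2).[z] * (expm1_poly K n.+1).[z] @[n --> \oo] --> z.
Proof.
move=> zr r2.
have r0 : 0 <= r by rewrite -iota0_le -zr.
pose rho := (r + 2 * pi) / 2.
have [rrho rho2] : r < rho /\ rho < 2 * pi.
  by rewrite /rho; move: (pi) r2 => p; lra.
have rho0 : 0 < rho by exact: le_lt_trans rrho.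
pose c := (1 + rho / 2 + cot_fun rho) * expR rho.
rewrite -[X in _ --> X]add0r.
rewrite [X in X @ _ --> _](_ : _ = fun n =>
  (bern_poly K n.+2 * expm1_poly K n.+1 - 'X).[z] + z); last first.
  by apply/funext => n; rewrite !hornerE subrK.
apply: cvgD; last exact: cvg_cst.
apply: (@cvg_geometric_bound c (r / rho)).
  by rewrite divr_ge0// ?(ltW rho0)//= ltr_pdivrMr// mul1r.
move=> n.
apply: (@le_trans _ _ (iota ((r / rho) ^+ n.+2 *
    ((\poly_(i < n.+2) `|bern R i|).[rho] * (expm1_poly R n.+1).[rho])))).
  apply: (@norm_truncated_mul_le n.+1 (bern_poly K n.+2)
    (expm1_poly K n.+1)) => //; last 1 first.
  - exact: ltW.
  - move=> i; rewrite !coef_poly; case: ifP => _; first by rewrite norm_bern.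
    by rewrite normr0 rmorph0.
  - move=> i; case: (leqP i n.+1) => iN.
      rewrite !coef_expm1// normrM !normfV !normr_nat.
      by rewrite rmorphM/= fmorphV/= !rmorph_nat.
    rewrite /expm1_poly !coefXM; case: i iN => // i iN /=.
    by rewrite !coef_poly ltnNge -ltnS iN normr0 rmorph0.
  - by move=> i iN; have /dvdXnP -> := bern_expm1 K n.+1.
  - move=> i iN; rewrite coefB coefX.
    by case: i iN => [|[|i]]// _; rewrite subr0.
  - by rewrite zr.
rewrite iota_le; apply: (@le_trans _ _ ((r / rho) ^+ n.+2 * c)).
  apply: ler_wpM2l; first by rewrite exprn_ge0// divr_ge0// ltW.
  apply: ler_pM.
  - rewrite horner_poly sumr_ge0// => i _.
    by rewrite mulr_ge0// exprn_ge0// ltW.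
  - rewrite horner_coef sumr_ge0// => -[i /= ilt] _.
    rewrite mulr_ge0 ?exprn_ge0 ?(ltW rho0)// coefXM; case: i {ilt} => //= i.
    by rewrite coef_poly; case: ifP.
  - by apply: bern_poly_abs_le; rewrite rho0.
  - apply: le_trans (exp_poly_le n.+1 (ltW rho0)).
    by rewrite /exp_poly hornerD hornerC lerDr.
have q0 : 0 <= r / rho by rewrite divr_ge0// ltW.
have q1 : r / rho <= 1 by rewrite ler_pdivrMr// mul1r ltW.
rewrite ler_wpM2r//; last by rewrite exprS ler_piMl// exprn_ge0.
rewrite mulr_ge0 ?expR_ge0// addr_ge0//.
  by rewrite addr_ge0// divr_ge0// ltW.
by apply: cot_fun_ge0; rewrite rho0.
Qed.

Lemma cvg_iota (u : nat -> R) l :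
  u @ \oo --> l -> iota (u n) @[n --> \oo] --> iota l.
Proof.
move=> ul; apply/subr_cvg0; apply: (@cvg0_le_real _ _ (fun n => `|u n - l|)).
  by move=> n; rewrite /= -rmorphB norm_iota.
by apply/norm_cvg0P/subr_cvg0.
Qed.

Lemma horner_exp_iota N (x : R) :
  (exp_poly K N).[iota x] = iota (exp_poly R N).[x].
Proof.
rewrite !horner_exp_poly rmorph_sum; apply: eq_bigr => i _ /=.
by rewrite fmorph_div/= rmorphXn rmorph_nat.
Qed.

Lemma cvg_exp_iota (x : R) :
  (exp_poly K n).[iota x] @[n --> \oo] --> iota (expR x).
Proof.
under eq_fun do rewrite horner_exp_iota.
exact/cvg_iota/cvg_exp_poly.
Qed.

(** An auxiliary variable s is introduced: e^(x s) e^(y s) and e^((x + y) s), truncated at order n,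
    agree up to s^n by the binomial formula. The remainder is evaluated at s = 1 and bounded through
    the values of the majorants at s = 2. *)
Lemma cvg_exp_mul (x y : K) :
  (exp_poly K n).[x] * (exp_poly K n).[y] - (exp_poly K n).[x + y]
    @[n --> \oo] --> 0.
Proof.
have [rx rx0 xE] := norm_realP x.
have [ry ry0 yE] := norm_realP y.
pose e (F : numFieldType) n (t : F) := \poly_(i < n.+1) (t ^+ i / i`!%:R).
have eE (F : numFieldType) n (t s : F) : (e F n t).[s] = (exp_poly F n).[s * t].
  rewrite horner_exp_poly horner_poly big_mkord; apply: eq_bigr => i _.
  by rewrite exprMn; ring.
apply: (@cvg_geometric_bound
  (expR (2 * rx) * expR (2 * ry)) 2^-1).
  by lra.
move=> n; pose D := e K n x * e K n y - e K n (x + y).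
have <- : D.[1] =
    (exp_poly K n).[x] * (exp_poly K n).[y] - (exp_poly K n).[x + y].
  by rewrite /D hornerD hornerN hornerM !eE !mul1r.
apply: (@le_trans _ _ (iota ((1 / 2) ^+ n.+1 *
    ((e R n rx).[2] * (e R n ry).[2])))).
  apply: (norm_truncated_mul_le (p := e K n x) (q := e K n y)) => //.
  - move=> i; rewrite !coef_poly.
    case: ifP => _; last by rewrite normr0 rmorph0.
    rewrite normrM normrX normfV normr_nat xE.
    by rewrite fmorph_div/= rmorphXn rmorph_nat.
  - move=> i; rewrite !coef_poly.
    case: ifP => _; last by rewrite normr0 rmorph0.
    rewrite normrM normrX normfV normr_nat yE.
    by rewrite fmorph_div/= rmorphXn rmorph_nat.
  - move=> i iN; rewrite coefB coefM coef_poly ltnS iN.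
    apply/eqP; rewrite subr_eq0.
    rewrite addrC exprDn mulr_suml; apply/eqP/eq_bigr => -[j /= ji] _.
    rewrite ltnS in ji.
    rewrite !coef_poly !ltnS (leq_trans ji iN) (leq_trans (leq_subr _ _) iN).
    have E : 'C(i, j)%:R * (j`!%:R * (i - j)`!%:R) = i`!%:R :> K.
      by rewrite -!natrM bin_fact.
    have fj : j`!%:R != 0 :> K by rewrite pnatr_eq0 -lt0n fact_gt0.
    have fij : (i - j)`!%:R != 0 :> K by rewrite pnatr_eq0 -lt0n fact_gt0.
    have fi : i`!%:R != 0 :> K by rewrite pnatr_eq0 -lt0n fact_gt0.
    rewrite -[_ *+ 'C(i, j)]mulr_natr.
    move: fi fj fij; rewrite -E.
    move: ('C(i, j)%:R) (j`!%:R) ((i - j)`!%:R) => b c d.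
    rewrite !mulf_eq0 !negb_or => /and3P[b0 _ _] c0 d0; field.
    by rewrite b0 c0 d0.
  - by move=> i iN; rewrite coefB [X in _ - X]coef_poly ltnS leqNgt iN subr0.
  - by rewrite normr1 rmorph1.
  - by rewrite ler1n.
have e0 t : 0 <= t -> 0 <= (e R n t).[2].
  move=> t0; rewrite horner_poly sumr_ge0// => i _.
  by rewrite !mulr_ge0 ?invr_ge0 ?exprn_ge0.
rewrite iota_le div1r ler_wpM2l// ler_pM ?e0// eE exp_poly_le// mulr_ge0//.
Qed.

Lemma cvg_exp_add (x y ex ey : K) :
  (exp_poly K n).[x] @[n --> \oo] --> ex ->
  (exp_poly K n).[y] @[n --> \oo] --> ey ->
  (exp_poly K n).[x + y] @[n --> \oo] --> ex * ey.
Proof.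
move=> cx cy.
rewrite [X in X @ _ --> _](_ : _ = fun n =>
  (exp_poly K n).[x] * (exp_poly K n).[y]
  - ((exp_poly K n).[x] * (exp_poly K n).[y] - (exp_poly K n).[x + y])); last first.
  by apply/funext => n; rewrite subKr.
rewrite -[X in _ --> X]subr0; apply: cvgB; last exact: cvg_exp_mul.
exact: cvgM.
Qed.

Lemma cvg_expm1_poly (z e : K) : (exp_poly K n).[z] @[n --> \oo] --> e ->
  (expm1_poly K n.+1).[z] @[n --> \oo] --> e - 1.
Proof.
move=> ce; suff : (expm1_poly K n).[z] @[n --> \oo] --> e - 1.
  by rewrite -cvg_shiftS.
rewrite [X in X @ _ --> _](_ : _ = fun n => (exp_poly K n).[z] - 1).
  by apply: cvgB => //; exact: cvg_cst.
by apply/funext => n; rewrite /exp_poly hornerD hornerC addrC addKr.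
Qed.

Lemma cvg_bern_poly (z e : K) (r : R) : `|z| = iota r -> r < 2 * pi ->
  (exp_poly K n).[z] @[n --> \oo] --> e -> e != 1 ->
  (bern_poly K n).[z] @[n --> \oo] --> z / (e - 1).
Proof.
move=> zr r2 ce e1.
have e10 : e - 1 != 0 by rewrite subr_eq0.
have cE := cvg_expm1_poly ce.
rewrite -(cvg_shiftn 2).
have H := cvg_bern_expm1 zr r2.
apply: cvg_trans (cvgM H (cvgV e10 cE)).
apply: near_eq_cvg; near=> n; rewrite /= addn2 mulfK//.
by near: n; exact: cvgr_neq0 cE e10.
Unshelve. all: by end_near. Qed.

End RealNorms.

(** * The complex exponential *)

Section ComplexExp.
Variable R : realType.
Local Notation toC := (real_complex R).

Lemma complex_norm_real (z : R[i]) : exists r : R, `|z| = toC r.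
Proof. by eexists; exact: normc_def. Qed.

Lemma real_complex_le : {mono toC : x y / x <= y}.
Proof. by move=> x y; rewrite lecR. Qed.

Lemma exp_coeff_imaginary (b : R) k :
  ('i%C * b%:C%C) ^+ k / k`!%:R
    = (cos_coeff b k)%:C%C + 'i%C * (sin_coeff b k)%:C%C.
Proof.
rewrite /cos_coeff /sin_coeff /= exprMn.
have -> : 'i%C ^+ k = (if odd k then 'i%C else 1) * ((-1) ^+ k./2)%:C%C :> R[i].
  rewrite -{1}(odd_double_half k) exprD -mul2n exprM sqr_i rmorphXn rmorphN1.
  by case: (odd k).
have -> : k`!%:R^-1 = (k`!%:R^-1)%:C%C :> R[i] by rewrite fmorphV rmorph_nat.
rewrite -!exprnP -rmorphXn; case: ifP => ko /=; rewrite !rmorphM/=.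
  have -> : k.-1./2 = k./2.
    by case: k ko => //= k ko; rewrite uphalf_half (negbTE ko).
  by rewrite !mul0r add0r ?mul1r; ring.
by rewrite !mul0r mulr0 addr0 ?mul1r; ring.
Qed.

Lemma cvg_exp_imaginary (b : R) :
  (exp_poly R[i] n).['i%C * b%:C%C] @[n --> \oo]
    --> (Complex (cos b) (sin b) : (R[i] : numFieldType)).
Proof.
have -> : Complex (cos b) (sin b) = (cos b)%:C%C + 'i%C * (sin b)%:C%C.
  by rewrite [LHS]complexE.
rewrite [X in X @ _ --> _](_ : _ = fun n => toC (series (cos_coeff b) n.+1)
    + 'i%C * toC (series (sin_coeff b) n.+1)); last first.
  apply/funext => n; rewrite horner_exp_poly /series/= !rmorph_sum mulr_sumr.
  rewrite -big_split.
  by apply: eq_bigr => i _; rewrite exp_coeff_imaginary.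
have cc : series (cos_coeff b) @ \oo --> cos b.
  by rewrite unlock; exact: is_cvg_series_cos_coeff.
have cs : series (sin_coeff b) @ \oo --> sin b.
  by rewrite unlock; exact: is_cvg_series_sin_coeff.
apply: cvgD; last apply: cvgMl_tmp.
- apply: (cvg_iota complex_norm_real real_complex_le
    (u := fun n => series (cos_coeff b) n.+1)).
  by move: cc; rewrite -cvg_shiftS.
- apply: (cvg_iota complex_norm_real real_complex_le
    (u := fun n => series (sin_coeff b) n.+1)).
  by move: cs; rewrite -cvg_shiftS.
Qed.

Lemma cvg_exp_complex (z : R[i]) :
  (exp_poly R[i] n).[z] @[n --> \oo]
    --> (base_exp (F := Complexes) z : (R[i] : numFieldType)).
Proof.
rewrite {1}[z]complexE /=.
apply: (cvg_exp_add complex_norm_real real_complex_le).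
  exact: (cvg_exp_iota complex_norm_real real_complex_le).
exact: cvg_exp_imaginary.
Qed.

(** If e^(a + i b) = 1 then a = 0 and cos b = 1, so sin (|b| / 2) = 0; but this sine is positive for
    0 < |b| < 2 pi. *)
Lemma complex_exp_neq1 (z : R[i]) (r : R) : `|z| = toC r -> r < 2 * pi ->
  z != 0 -> base_exp (F := Complexes) z != 1.
Proof.
rewrite normc_def => -[zr] r2 z0; apply: contra_neq z0 => /=.
case: z zr => a b /= zr [].
rewrite !mul0r subr0 addr0 => ec es.
have e0 : expR a != 0 by rewrite gt_eqF ?expR_gt0.
have sb : sin b = 0 by move/eqP: es; rewrite mulf_eq0 (negbTE e0) => /eqP.
have c2 : cos b ^+ 2 = 1 by have := cos2Dsin2 b; rewrite sb expr0n addr0.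
have cb : cos b = 1.
  have cb0 : 0 < cos b by rewrite -(pmulr_rgt0 _ (expR_gt0 a)) ec.
  by apply/eqP; rewrite -(@eqrXn2 _ 2) ?ltW// c2 expr1n.
have a0 : a = 0 by apply: expR_inj; rewrite expR0 -ec cb mulr1.
have b2 : `|b| < 2 * pi.
  apply: le_lt_trans r2; rewrite -zr -sqrtr_sqr ler_sqrt ?lerDr ?sqr_ge0//.
  by rewrite addr_ge0 ?sqr_ge0.
have b0 : b = 0.
  apply/eqP; rewrite -normr_le0 leNgt; apply/negP => b0.
  have s0 : 0 < sin (`|b| / 2) by apply: sin_half_gt0; rewrite b0.
  have := cos_norm b; rewrite -[`|b|](divfK (x := 2)) ?pnatr_eq0//.
  rewrite mulr_natr cos_mulr2n cb cos2sin2 => E.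
  have : sin (`|b| / 2) ^+ 2 = 0 by move: E; move: (sin _) => s; lra.
  by move/eqP; rewrite sqrf_eq0 gt_eqF.
by rewrite a0 b0.
Qed.

Lemma real_exp_neq1 (z : R) : z != 0 -> expR z != 1.
Proof. by apply: contra_neq => e1; apply: expR_inj; rewrite expR0. Qed.

End ComplexExp.

(** * Divergence on the circle of radius 2 pi *)

Section Divergence.
Variable R : realType.
Local Notation toC := (real_complex R).

(** The first [N] terms are bounded by their values at radius 2 pi, the others by the geometric
    series e (1 - s)^i of sum e / s. *)
Lemma bern_poly_abs_geometric N e (s : R) : 0 < s < 1 ->
  (forall n, (N <= n)%N -> `|bern R n| * (2 * pi) ^+ n <= e) -> 0 <= e ->
  forall n, (\poly_(i < n) `|bern R i|).[2 * pi * (1 - s)]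
    <= \sum_(i < N) `|bern R i| * (2 * pi) ^+ i + e / s.
Proof.
move=> /andP[s0 s1] be e0 n; rewrite horner_poly.
set c := fun i => `|bern R i| * (2 * pi) ^+ i.
have pi0 : 0 <= 2 * pi :> R by rewrite mulr_ge0 ?pi_ge0.
have c0 i : 0 <= c i by rewrite /c mulr_ge0 ?exprn_ge0.
have q0 : 0 <= 1 - s by rewrite subr_ge0 ltW.
apply: (@le_trans _ _ (\sum_(i < n) ((i < N)%N%:R * c i + e * (1 - s) ^+ i))).
  apply: ler_sum => -[i /= _] _; rewrite exprMn mulrA -/(c i).
  have q1 : (1 - s) ^+ i <= 1 by rewrite exprn_ile1// gerBl ltW.
  have [iN|Ni] := ltnP i N.
    rewrite mul1r -[X in X <= _]addr0 lerD ?mulr_ge0 ?exprn_ge0//.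
    by rewrite ler_piMr.
  by rewrite mul0r add0r ler_wpM2r ?exprn_ge0// be.
rewrite big_split/= lerD//.
  rewrite -(big_mkord xpredT (fun i => (i < N)%N%:R * c i)).
  rewrite -(big_mkord xpredT c).
  have [nN|Nn] := leqP n N.
    rewrite [X in _ <= X](big_cat_nat _ nN)//= -[X in X <= _]addr0.
    rewrite lerD ?sumr_ge0// big_nat [X in _ <= X]big_nat ler_sum// => i _.
    by case: (i < N)%N; rewrite ?mul1r ?mul0r.
  rewrite (big_cat_nat _ (ltnW Nn))//= [X in _ + X]big_nat.
  rewrite [X in _ + X]big1 ?addr0.
    rewrite big_nat [X in _ <= X]big_nat ler_sum// => i _.
    by case: (i < N)%N; rewrite ?mul1r ?mul0r.
  by move=> i /andP[Ni _]; rewrite ltnNge Ni mul0r.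
rewrite -mulr_sumr ler_wpM2l// -div1r ler_pdivlMr// mulrC.
have := subrX1 (1 - s) n; rewrite addrAC subrr sub0r mulNr => E.
have -> : s * (\sum_(i < n) (1 - s) ^+ i) = 1 - (1 - s) ^+ n by move: E; lra.
by rewrite gerBl exprn_ge0.
Qed.

Lemma bern_not_cvg0 : ~ (`|bern R n| * (2 * pi) ^+ n @[n --> \oo] --> 0).
Proof.
move=> /cvgr0_norm_le/(_ (8^-1)) []; first by rewrite invr_gt0.
move=> N _ bN.
have be n : (N <= n)%N -> `|bern R n| * (2 * pi) ^+ n <= 8^-1.
  by move=> Nn; apply: le_trans (ler_norm _) (bN n Nn).
have pi0 := pi_gt0 R.
have pip : 0 < 2 * pi :> R by rewrite mulr_gt0.
set A := \sum_(i < N) `|bern R i| * (2 * pi) ^+ i.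
have A0 : 0 <= A.
  by rewrite /A sumr_ge0// => i _; rewrite mulr_ge0// exprn_ge0// ltW.
(* With this [s], the final estimate of y by d + 3 d B equals 2 pi (1 / 8 + 3 / 8) = pi, whereas y =
   2 pi (1 - s) is at least 7 pi / 4. *)
pose s := (8 * (1 + 3 * A))^-1.
have sA : s * (1 + 3 * A) = 8^-1.
  by rewrite /s invfM mulfVK// gt_eqF// ltr_wpDr// mulr_ge0.
have s0 : 0 < s by rewrite invr_gt0 mulr_gt0// ltr_wpDr// mulr_ge0.
have s8 : s <= 8^-1.
  by rewrite -sA ler_peMr ?(ltW s0)// lerDl mulr_ge0.
have s1 : s < 1 by move: s8; lra.
pose y : R := 2 * pi * (1 - s); pose d : R := 2 * pi * s.
have d0 : 0 < d by rewrite mulr_gt0.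
have y0 : 0 <= y by rewrite mulr_ge0 ?ltW ?subr_gt0.
have yd : y = 2 * pi - d by rewrite /y /d; ring.
pose z := 'i%C * y%:C%C : (R[i] : numFieldType).
have zy : `|z| = toC y.
  rewrite normc_def /=; congr (toC _).
  rewrite !mul0r !mul1r sub0r oppr0 add0r expr0n add0r sqrtr_sqr ger0_norm//.
have yp : y < 2 * pi by rewrite yd ltrBlDr ltrDl.
pose B := A + 8^-1 / s.
have PB n : `|(bern_poly R[i] n).[z]| <= toC B.
  apply: (@le_trans _ _ (toC (\poly_(i < n) `|bern R i|).[y])).
    apply: norm_horner_le; last by rewrite zy.
    move=> i; rewrite !coef_poly; case: ifP => _; last by rewrite normr0 lexx.
    by rewrite (norm_bern (iota := toC) (@real_complex_le R)).
  by rewrite real_complex_le; apply: bern_poly_abs_geometric; rewrite ?s0.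
pose e := Complex (cos y) (sin y) : (R[i] : numFieldType).
have ce : (expm1_poly R[i] n.+1).[z] @[n --> \oo] --> e - 1.
  by apply: cvg_expm1_poly; exact: cvg_exp_imaginary.
(* Since y = 2 pi - d, [e] is e^(- i d), and both |cos d - 1| and |sin d| are at most d. *)
have e2d : `|e - 1| <= toC (2 * d).
  have -> : e - 1 = toC (cos d - 1) - 'i%C * toC (sin d).
    rewrite /e yd; have -> : 2 * pi = pi *+ 2 :> R by rewrite mulr_natl.
    rewrite cosB sinB cos2pi sin2pi !mul0r !mul1r sub0r addr0.
    apply/eqP; rewrite eq_complex /=; apply/andP; split; apply/eqP; ring.
  apply: le_trans (ler_normB _ _) _.
  rewrite normrM !(norm_iota (@real_complex_le R)).
  have -> : `|'i%C : R[i]| = 1.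
    by rewrite normc_def /= expr0n expr1n add0r sqrtr1.
  rewrite mul1r -rmorphD real_complex_le [2 * d]mulr_natl mulr2n lerD//.
    by rewrite distrC ger0_norm ?subr_ge0 ?cos_le1// one_sub_cos_le// ltW.
  rewrite ger0_norm ?sin_le_id ?(ltW d0)// sin_ge0_pi// (ltW d0)/= /d.
  by rewrite mulrAC ger_pMl//; move: s8; lra.
have cPE := cvg_bern_expm1 (@complex_norm_real R) (@real_complex_le R) zy yp.
have dC0 : 0 < toC d by rewrite -[0]/(toC 0) ltcR.
have /cvgrPdist_lt/(_ _ dC0) nP := cPE.
have /cvgrPdist_lt/(_ _ dC0) nE := ce.
(* For such an n, the truncation of e^z - 1 has norm at most 2 d + d, so y = |z| is less than d + B
   (3 d). *)
have [n [Pn En]] : exists n,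
    `|z - (bern_poly R[i] n.+2).[z] * (expm1_poly R[i] n.+1).[z]| < toC d
    /\ `|e - 1 - (expm1_poly R[i] n.+1).[z]| < toC d.
  have [n] := filter_ex (filterI nP nE).
  by move=> [? ?]; exists n.
have B0 : 0 <= B by rewrite addr_ge0// divr_ge0// ltW.
have : toC y < toC (d + B * (3 * d)).
  rewrite -zy rmorphD.
  rewrite -[z](subrK
    ((bern_poly R[i] n.+2).[z] * (expm1_poly R[i] n.+1).[z])).
  apply: le_lt_trans (ler_normD _ _) _; apply: ltr_leD => //.
  rewrite normrM rmorphM ler_pM//.
  rewrite -[X in `|X|](subKr (e - 1)) (le_trans (ler_normB _ _))//.
  have -> : 3 * d = 2 * d + d by ring.
  by rewrite rmorphD lerD// ltW.
rewrite ltcR /B.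
have -> : d + (A + 8^-1 / s) * (3 * d)
    = 2 * pi * (s * (1 + 3 * A) + 3 / 8).
  rewrite /d; field; exact: lt0r_neq0.
by rewrite sA /y ltr_pM2l//; lra.
Qed.

End Divergence.

(** * Convergence and divergence of the BCH series over an abstract ground field *)

Section BCHSeries.
Variables (R : realType) (K : numFieldType) (iota : {rmorphism R -> K}).
Hypothesis norm_real : forall z : K, exists r : R, `|z| = iota r.
Hypothesis iota_le : {mono iota : x y / x <= y}.
Variable expK : K -> K.
Hypothesis expK_cvg : forall z, (exp_poly K n).[z] @[n --> \oo] --> expK z.
Hypothesis expK_neq1 : forall (z : K) (r : R),
  `|z| = iota r -> r < 2 * pi -> z != 0 -> expK z != 1.
Variables (A : normedModType K) (br : A -> A -> A).
Hypothesis brl : forall (a : K) x y z, br (a *: x + y) z = a *: br x z + br y z.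
Hypothesis brr : forall (a : K) x y z, br z (a *: x + y) = a *: br z x + br z y.
Hypothesis brxx : forall x, br x x = 0.
Variables (X Y : A) (v : K).
Hypothesis brXY : br X Y = v *: Y.

Let iota_lt : {mono iota : x y / x < y}.
Proof. exact: leW_mono. Qed.

(** The coefficient b_0 = 1 supplies the [Y] of Z_1 = X + Y. *)
Lemma BCH_partial_sumE N :
  BCH_partial_sum br X Y N.+1 = X + (bern_poly K N.+1).[- v] *: Y.
Proof.
rewrite /BCH_partial_sum big_ltn// (BCH_Z1 brl brr brxx brXY).
rewrite horner_poly big_ord_recl bern0 expr0 mulr1 scalerDl scale1r addrA.
congr (_ + _); rewrite big_add1/= big_add1 big_mkord scaler_suml.
by apply: eq_bigr => i _; rewrite (BCH_ZS brl brr brxx brXY)// mulrC.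
Qed.

Lemma BCH_cvg : `|v| < iota (2 * pi) ->
  BCH_partial_sum br X Y @ \oo -->
    X + (if v == 0 then 1 else v / (1 - expK (- v))) *: Y.
Proof.
move=> v2; rewrite -cvg_shiftS.
under eq_fun do rewrite BCH_partial_sumE.
apply: cvgD; first exact: cvg_cst.
apply: cvgZr_tmp.
have [v0|v0] := eqVneq v 0.
  rewrite (_ : (fun n => _) = cst 1); first exact: cvg_cst.
  apply/funext => n; rewrite v0 oppr0 horner_coef0 coef_poly/=; exact: bern0.
have [r vr] := norm_real v; rewrite vr iota_lt in v2.
have nvr : `|- v| = iota r by rewrite normrN.
have nv0 : - v != 0 by rewrite oppr_eq0.
rewrite (_ : v / _ = - v / (expK (- v) - 1)); last first.
  by rewrite -[1 - _]opprB invrN mulrN mulNr.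
have := cvg_bern_poly norm_real iota_le nvr v2 (expK_cvg (z := - v))
  (expK_neq1 nvr v2 nv0).
by rewrite -cvg_shiftS.
Qed.

(** Convergence would force the general term to 0; dividing by the norm of [Y], |b_n| |v|^n would
    tend to 0, and so would |b_n| (2 pi)^n, against [bern_not_cvg0]. *)
Lemma BCH_not_cvg : Y != 0 -> iota (2 * pi) <= `|v| ->
  ~ cvgn (BCH_partial_sum br X Y).
Proof.
move=> Y0 v2 cS; apply: (@bern_not_cvg0 R).
have [r vr] := norm_real v.
have [t] := norm_real `|Y|; rewrite normr_id => yt.
rewrite vr iota_le in v2.
have t0 : 0 < t by rewrite -iota_lt rmorph0 -yt normr_gt0.
have cZ : BCH_Z br n.+1 X Y @[n --> \oo] --> 0.
  have : (BCH_partial_sum br X Y n.+1 - BCH_partial_sum br X Y n)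
      @[n --> \oo] --> 0.
    rewrite -(subrr (limn (BCH_partial_sum br X Y))).
    by apply: cvgB => //; rewrite cvg_shiftS.
  apply: cvg_trans; apply: near_eq_cvg; apply: nearW => n.
  by rewrite /BCH_partial_sum big_nat_recr//= addrAC subrr add0r.
have cZ2 : BCH_Z br n.+2 X Y @[n --> \oo] --> 0.
  by move: cZ; rewrite -cvg_shiftS.
have uE n : `|BCH_Z br n.+2 X Y| = iota (r ^+ n.+1 * `|bern R n.+1| * t).
  rewrite (BCH_ZS brl brr brxx brXY)// normrZ normrM normrX normrN vr yt.
  by rewrite (norm_bern iota_le) !rmorphM rmorphXn.
have /(cvgMr_tmp (b := t^-1)) := cvg0_real_eq iota_le uE cZ2.
rewrite mul0r => cu.
rewrite -cvg_shiftS; apply: (squeeze_cvgr _ (cvg_cst 0) cu).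
apply: nearW => n; rewrite mulfK ?gt_eqF// [_ ^+ _ * _]mulrC.
rewrite mulr_ge0 ?exprn_ge0 ?mulr_ge0 ?pi_ge0//= ler_wpM2l// lerXn2r// nnegrE.
  by rewrite mulr_ge0 ?pi_ge0.
by rewrite (le_trans _ v2)// mulr_ge0 ?pi_ge0.
Qed.

End BCHSeries.

Theorem theorem2p5 (R : realType) (F : ground_field)
    (A : completeNormedModType (base_field R F)) (br : A -> A -> A)
    (hbr : banach_bracket br) (X Y : A) (v : base_field R F)
    (hY : Y != 0) (hXY : br X Y = v *: Y) :
  [/\ BCH_Z br 1 X Y = X + Y,
      forall n : nat, (1 <= n)%N ->
        BCH_Z br n.+1 X Y = ((- v) ^+ n * ratr (bernoulli_number n) / n`!%:R) *: Y,
      cvgn (BCH_partial_sum br X Y) <->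
        `|v| < base_of_real F (2 * pi),
      `|v| < base_of_real F (2 * pi) ->
        BCH_partial_sum br X Y @ \oo --> X + psi v *: Y &
      base_of_real F (2 * pi) <= `|v| ->
        ~ cvgn (BCH_partial_sum br X Y)].
Proof.
have {hbr} hbr : banach_lie_bracket br.
  by case: hbr => [//|[one [mul [mulP ->]]]]; exact: commutator_banach_lie mulP.
have brl := br_linearl hbr; have brr := br_linearr hbr.
have brxx := br_alternating hbr.
(* The order on [R[i]] is only partial, so the comparability [vle] of |v| with 2 pi is proved for
   each field separately; it turns the two one-sided statements into the equivalence. *)
suff [vle cvgS ncvgS] :
  [/\ base_of_real F (2 * pi) <= `|v| \/ `|v| < base_of_real F (2 * pi),
      `|v| < base_of_real F (2 * pi) ->
        BCH_partial_sum br X Y @ \oo --> X + psi v *: Y &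
      base_of_real F (2 * pi) <= `|v| ->
        ~ cvgn (BCH_partial_sum br X Y)].
  split=> //.
  - exact: (BCH_Z1 brl brr brxx hXY).
  - by move=> n n1; rewrite (BCH_ZS brl brr brxx hXY)// mulrA.
  - split=> [cS|/cvgS cS]; last by apply/cvg_ex; eexists; exact: cS.
    by case: vle => // /ncvgS.
clear hbr.
case: F A br X Y v hY hXY brl brr brxx => A br X Y v hY hXY brl brr brxx.
- have norm_real (z : R) : exists r : R, `|z| = idfun r by exists `|z|.
  have exp_neq1 (z r : R) :
      `|z| = idfun r -> r < 2 * pi -> z != 0 -> expR z != 1.
    by move=> _ _ ?; exact: real_exp_neq1.
  split.
  + by case: (leP (2 * pi) `|v|); [left|right].
  + exact: (BCH_cvg norm_real _ (@cvg_exp_poly R) exp_neq1 brl brr brxx hXY).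
  + exact: (BCH_not_cvg norm_real _ brl brr brxx hXY hY).
- split.
  + have [r ->] := complex_norm_real v; rewrite real_complex_le ltcR.
    by case: (leP (2 * pi) r); [left|right].
  + exact: (BCH_cvg (@complex_norm_real R) (@real_complex_le R)
      (@cvg_exp_complex R) (@complex_exp_neq1 R) brl brr brxx hXY).
  + exact: (BCH_not_cvg (@complex_norm_real R) (@real_complex_le R)
      brl brr brxx hXY hY).
Qed.
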